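(* Let $n$ and $r$ be positive integers. There is a deterministic algorithm that, given $n$ and $r$, constructs an $(n,r)$-strongly-selective family of size $\Theta(\min[r^2\ln n,\, n])$, and runs in $\Theta(rn\ln n)$ time.
   Context: Let $U=[n]=\{1,\dots,n\}$. Given $A\subseteq U$, an element $x\in A$ is selected by a set $B\subseteq U$ if $A\cap B=\{x\}$, and it is selected by a family $\mathcal{F}$ of subsets of $U$ if some member of $\mathcal{F}$ selects it. A family $\mathcal{F}$ of subsets of $U$ is an $(n,r)$-strongly-selective family ($(n,r)$-SSF) if for every subset $A\subseteq U$ with $|A|=r$, every element of $A$ is selected by $\mathcal{F}$. The size of the family is the number of sets in it. *)

(* Defs.v *)
From mathcomp Require Import all_boot all_order all_algebra.
From mathcomp Require Import reals exp.

Set Implicit Arguments.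
Unset Strict Implicit.
Unset Printing Implicit Defensive.

Import Order.TTheory GRing.Theory Num.Theory.

(* The universe {1, ..., n} is 'I_n, the element k being the ordinal of value
   k - 1. *)

Definition selects (T : finType) (A B : {set T}) (x : T) : Prop :=
  A :&: B = [set x].

Definition selected_by (T : finType) (A : {set T}) (F : {set {set T}}) (x : T)
    : Prop :=
  exists2 B : {set T}, B \in F & selects A B x.

Definition strongly_selective (n r : nat) (F : {set {set 'I_n}}) : Prop :=
  forall A : {set 'I_n}, #|A| = r -> forall x, x \in A -> selected_by A F x.

Arguments strongly_selective : clear implicits.

(* Deterministic algorithms are programs for a unit-cost word RAM: finitely many
   registers (those the program mentions), a memory of words that is initially
   0, and a write-only output tape.  A word is a natural number below 2 ^ w;
   arithmetic is reduced modulo 2 ^ w, except that subtraction is truncated at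
   0.  Division and remainder by 0 give what %/ and %% give on nat. *)

Inductive binop := OAdd | OSub | OMul | ODiv | OMod | OEq | OLt.

Inductive expr :=
  | Lit of nat
  | Reg of nat
  | Fetch of expr
  | Bin of binop & expr & expr.

Inductive cmd :=
  | Skip
  | Assign of nat & expr
  | Store of expr & expr
  | Output of expr
  | Seq of cmd & cmd
  | If of expr & cmd & cmd
  | While of expr & cmd.

Record state := State {
  regs : nat -> nat;
  memory : nat -> nat;
  tape : seq nat
}.

Definition upd (f : nat -> nat) (a v : nat) : nat -> nat :=
  fun b => if b == a then v else f b.

Definition eval_binop (o : binop) (x y : nat) : nat :=
  match o with
  | OAdd => x + y
  | OSub => x - y
  | OMul => x * y
  | ODiv => x %/ y
  | OMod => x %% y
  | OEq => x == y
  | OLt => x < y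
  end.

Fixpoint eval (w : nat) (s : state) (e : expr) : nat :=
  match e with
  | Lit k => k %% 2 ^ w
  | Reg x => regs s x
  | Fetch e1 => memory s (eval w s e1)
  | Bin o e1 e2 => eval_binop o (eval w s e1) (eval w s e2) %% 2 ^ w
  end.

Fixpoint cost (e : expr) : nat :=
  match e with
  | Lit _ | Reg _ => 1
  | Fetch e1 => (cost e1).+1
  | Bin _ e1 e2 => (cost e1 + cost e2).+1
  end.

(* exec w p s t s': on words of w bits, p started in s halts in s' after exactly
   t elementary operations.  A nonzero word counts as true. *)
Inductive exec (w : nat) : cmd -> state -> nat -> state -> Prop :=
  | ESkip s : exec w Skip s 1 s
  | EAssign x e s :
      exec w (Assign x e) s (cost e).+1
        (State (upd (regs s) x (eval w s e)) (memory s) (tape s))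
  | EStore a e s :
      exec w (Store a e) s (cost a + cost e).+1
        (State (regs s) (upd (memory s) (eval w s a) (eval w s e)) (tape s))
  | EOutput e s :
      exec w (Output e) s (cost e).+1
        (State (regs s) (memory s) (rcons (tape s) (eval w s e)))
  | ESeq p q s s1 s2 t1 t2 :
      exec w p s t1 s1 -> exec w q s1 t2 s2 ->
      exec w (Seq p q) s (t1 + t2) s2
  | EIfTrue e p q s s1 t :
      eval w s e != 0 -> exec w p s t s1 ->
      exec w (If e p q) s ((cost e).+1 + t) s1
  | EIfFalse e p q s s1 t :
      eval w s e = 0 -> exec w q s t s1 ->
      exec w (If e p q) s ((cost e).+1 + t) s1
  | EWhileTrue e p s s1 s2 t1 t2 :
      eval w s e != 0 -> exec w p s t1 s1 -> exec w (While e p) s1 t2 s2 ->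
      exec w (While e p) s ((cost e).+1 + t1 + t2) s2
  | EWhileFalse e p s :
      eval w s e = 0 -> exec w (While e p) s (cost e).+1 s.

Lemma exec_det (w : nat) (p : cmd) (s s1 s2 : state) (t1 t2 : nat) :
  exec w p s t1 s1 -> exec w p s t2 s2 -> t1 = t2 /\ s1 = s2.
Proof.
move=> H; elim: H t2 s2 => {p s t1 s1}.
- by move=> s t2 s2 H; inversion H.
- by move=> x e s t2 s2 H; inversion H.
- by move=> a e s t2 s2 H; inversion H.
- by move=> e s t2 s2 H; inversion H.
- move=> p q s s1 s2 t1 t2 _ IHp _ IHq t s' H; inversion H; subst.
  have [] := IHp _ _ ltac:(eassumption) => ? ?; subst.
  by have [] := IHq _ _ ltac:(eassumption) => ? ?; subst.
- move=> e p q s s1 t ez _ IH t' s' H; inversion H; subst.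
    by have [] := IH _ _ ltac:(eassumption) => ? ?; subst.
  by have /eqP := ez.
- move=> e p q s s1 t ez _ IH t' s' H; inversion H; subst.
    by have /eqP := ltac:(eassumption) : is_true (eval w s e != 0).
  by have [] := IH _ _ ltac:(eassumption) => ? ?; subst.
- move=> e p s s1 s2 t1 t2 ez _ IHp _ IHw t s' H; inversion H; subst.
    have [] := IHp _ _ ltac:(eassumption) => ? ?; subst.
    by have [] := IHw _ _ ltac:(eassumption) => ? ?; subst.
  by have /eqP := ez.
- move=> e p s ez t s' H; inversion H; subst => //.
  by have /eqP := ltac:(eassumption) : is_true (eval w s e != 0).
Qed.

Definition init (n r : nat) : state :=
  State (fun x => if x == 0 then n else if x == 1 then r else 0) (fun=> 0) [::].

(* c times the number of bits of n + r, i.e. words of O(log (n + r)) bits *)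
Definition word_size (c n r : nat) : nat := c * (trunc_log 2 (n + r)).+1.

(* The sets are written one after the other, each as the increasing list of its
   elements (numbered from 1) followed by the end marker 0. *)
Definition encode (n : nat) (l : seq {set 'I_n}) : seq nat :=
  flatten [seq rcons [seq (val i).+1 | i <- enum B] 0 | B : {set 'I_n} <- l].

Definition outputs (c : nat) (p : cmd) (n r : nat) (l : seq {set 'I_n})
    (t : nat) : Prop :=
  exists2 s : state, exec (word_size c n r) p (init n r) t s
                   & tape s = encode l.

Arguments outputs : clear implicits.

Local Open Scope ring_scope.

(* n = 1 is left out: there ln n = 0, while a (1, 1)-strongly-selective family
   is nonempty and every run takes at least one step. *)
Definition Theta (R : realType) (f : nat -> nat -> nat) (g : nat -> nat -> R)
    : Prop :=
  exists a b : R, [/\ 0 < a, 0 < b &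
    forall n r : nat, (1 < n)%N -> (0 < r)%N ->
      a * g n r <= (f n r)%:R <= b * g n r].

(* Main.v *)
Require Import Defs.
From mathcomp Require Import all_boot all_order all_algebra.
From mathcomp Require Import zify boolp reals exp.
From Stdlib Require PeanoNat.

Set Implicit Arguments.
Unset Strict Implicit.
Unset Printing Implicit Defensive.

Import Order.TTheory GRing.Theory Num.Theory.

(* Let K be the bit length of n.  If n <= r^2 K, the singletons do.  Otherwise
   take a power of two q with 4r <= q <= 8r and m = 2rK maps L from [0, 2^K) to
   [0, q) that are linear for bitwise xor; the sets {u | L u = v} form an
   (n,r)-SSF as soon as every z with 0 < z < 2^K is killed by fewer than 2K of
   the maps: x and y collide under L iff L (x xor y) = 0, so fewer than
   2K(r - 1) < m maps make x collide with an element of A \ {x}.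

   The maps are found one after the other by the method of conditional
   expectations, with the potential sum_{z > 0} 2^(number of maps killing z).
   The images L(2^i) are chosen for i = 0, ..., K - 1: the z in [2^i, 2^(i+1))
   killed by L are those with L(z - 2^i) = L(2^i), so we sort the weights of
   these z into q buckets by L(z - 2^i) and take for L(2^i) the lightest
   bucket.  Each map thus multiplies the potential by at most 1 + 1/q, which
   keeps it below 4^K.  This is the Porat-Rothschild derandomization of the
   Gilbert-Varshamov bound, with xor-linear maps instead of linear codes over a
   field with q elements, so that no prime or field arithmetic is needed.

   Each map costs O(n) steps, including the output of its sets through linked
   lists.  The first min(n, r^2 K) singletons, output in all cases, give the
   lower bound on the number of distinct sets, and a final idle loop of r n K
   rounds gives the lower bound on the time. *)

Local Notation xor := PeanoNat.Nat.lxor.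

(** * Xor-linear maps and the potential *)

(** The word RAM has no xor instruction; this recursion on the last binary digit expresses xor by
    arithmetic. It drives the inductions on bit length and the filling of the xor table. *)
Lemma xor_half (a b : nat) :
  xor a b = 2 * xor (a %/ 2) (b %/ 2) + (a %% 2 + b %% 2) %% 2.
Proof.
have E c : PeanoNat.Nat.testbit c 0 = odd c.
  rewrite PeanoNat.Nat.bit0_odd -PeanoNat.Nat.negb_even -[RHS]negbK; congr negb.
  by elim/ltn_ind: c => -[|[|c]] IH //=; rewrite IH //= !negbK.
rewrite [LHS](PeanoNat.Nat.div2_odd (xor a b)) -PeanoNat.Nat.bit0_odd.
rewrite PeanoNat.Nat.lxor_spec !E PeanoNat.Nat.div2_div.
have D c : PeanoNat.Nat.div2 c = c %/ 2.
  by rewrite divn2; elim/ltn_ind: c => -[|[|c]] IH //=; rewrite IH.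
rewrite -PeanoNat.Nat.div2_div PeanoNat.Nat.div2_spec PeanoNat.Nat.shiftr_lxor
  -!PeanoNat.Nat.div2_spec !D !modn2.
rewrite -multE -plusE; congr (_ + _).
by case: (odd a); case: (odd b).
Qed.

Lemma xor_lt (k a b : nat) : a < 2 ^ k -> b < 2 ^ k -> xor a b < 2 ^ k.
Proof.
elim: k a b => [|k IH] a b;
  first by rewrite expn0 !ltnS !leqn0 => /eqP-> /eqP->.
rewrite expnS => Ha Hb; rewrite xor_half.
have := IH (a %/ 2) (b %/ 2) ltac:(lia) ltac:(lia).
lia.
Qed.

(** As [x] lies below [2 ^ k], adding [2 ^ k] merely sets bit [k], which [y] lacks. *)
Lemma xor_addl (k x y : nat) :
  x < 2 ^ k -> y < 2 ^ k -> xor (2 ^ k + x) y = 2 ^ k + xor x y.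
Proof.
elim: k x y => [|k IH] x y;
  first by rewrite expn0 !ltnS !leqn0 => /eqP-> /eqP->.
rewrite expnS => Hx Hy; rewrite xor_half [in RHS]xor_half.
have -> : (2 * 2 ^ k + x) %/ 2 = 2 ^ k + x %/ 2 by lia.
rewrite IH; lia.
Qed.

Lemma xor_add2l (k x y : nat) :
  x < 2 ^ k -> y < 2 ^ k -> xor (2 ^ k + x) (2 ^ k + y) = xor x y.
Proof.
move=> Hx Hy; have k0 : 0 < 2 ^ k by rewrite expn_gt0.
have E z : z < 2 ^ k -> 2 ^ k + z = xor (2 ^ k) z.
  by move=> Hz; rewrite -{2}[2 ^ k]addn0 xor_addl // PeanoNat.Nat.lxor_0_l.
rewrite !E // [xor (2 ^ k) x]PeanoNat.Nat.lxor_comm -PeanoNat.Nat.lxor_assoc.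
by rewrite [xor (xor x _) _]PeanoNat.Nat.lxor_assoc PeanoNat.Nat.lxor_nilpotent
  PeanoNat.Nat.lxor_0_r.
Qed.

(** This is linearity in the shape in which the program builds a map: the image of each power of two
    is chosen, and the rest follows by splitting off the top bit. Full additivity is
    [xor_linearP]. *)
Definition xor_linear (K : nat) (L : nat -> nat) : Prop :=
  L 0 = 0 /\
  forall i z, i < K -> z < 2 ^ i -> L (2 ^ i + z) = xor (L (2 ^ i)) (L z).

(** Induction on the bit length, by cases on the top bits of [x] and [y]; when both are set they
    cancel, and so do the two copies of [L (2 ^ K)]. *)
Lemma xor_linearP (K : nat) (L : nat -> nat) (x y : nat) :
  xor_linear K L -> x < 2 ^ K -> y < 2 ^ K -> L (xor x y) = xor (L x) (L y).
Proof.
move=> [L0 HL]; elim: K HL x y => [|K IH] HL x y.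
  by rewrite expn0 !ltnS !leqn0 => /eqP-> /eqP->; rewrite /= !L0.
have {}IH := IH (fun i z iK => HL i z (ltnW iK)).
have H := HL K _ (leqnn _).
have C := PeanoNat.Nat.lxor_comm; have A := PeanoNat.Nat.lxor_assoc.
rewrite expnS mul2n -addnn => Hx Hy.
case: (ltnP x (2 ^ K)) => x2; case: (ltnP y (2 ^ K)) => y2.
- exact: IH.
- have [y' E] : exists y', y = 2 ^ K + y' by exists (y - 2 ^ K); lia.
  have y'K : y' < 2 ^ K by lia.
  by rewrite E C xor_addl // H ?xor_lt // (H y') // IH // -A [RHS]C.
- have [x' E] : exists x', x = 2 ^ K + x' by exists (x - 2 ^ K); lia.
  have x'K : x' < 2 ^ K by lia.
  by rewrite E xor_addl // H ?xor_lt // (H x') // IH // A.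
- rewrite -(subnKC x2) -(subnKC y2) xor_add2l; [|lia|lia].
  rewrite IH; [|lia|lia]; rewrite !H; [|lia|lia].
  rewrite [xor (L (2 ^ K)) (L (x - _))]C -A [xor (xor _ _) (L (2 ^ K))]A.
  by rewrite PeanoNat.Nat.lxor_nilpotent PeanoNat.Nat.lxor_0_r.
Qed.

(** * The potential and its growth *)

Definition zeros (Ls : seq (nat -> nat)) (z : nat) : nat :=
  \sum_(L <- Ls) (L z == 0).

(** The sum starts at 1 because every linear map kills 0. *)
Definition potential (Ls : seq (nat -> nat)) (N : nat) : nat :=
  \sum_(1 <= z < N) 2 ^ zeros Ls z.

Lemma zeros_rcons Ls L z : zeros (rcons Ls L) z = zeros Ls z + (L z == 0).
Proof. by rewrite /zeros -cats1 big_cat big_seq1. Qed.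

(** A new map doubles the terms of the [z] that it kills and keeps the others, so the potential
    grows by exactly the killed weight. *)
Lemma potential_rcons (q N : nat) (Ls : seq (nat -> nat)) (L : nat -> nat) :
  q * (\sum_(1 <= z < N | L z == 0) 2 ^ zeros Ls z) <= potential Ls N ->
  q * potential (rcons Ls L) N <= q.+1 * potential Ls N.
Proof.
move=> H; have -> : potential (rcons Ls L) N =
    potential Ls N + \sum_(1 <= z < N | L z == 0) 2 ^ zeros Ls z.
  rewrite /potential [X in _ + X]big_mkcond -big_split /=;
    apply: eq_bigr => z _.
  by rewrite zeros_rcons; case: eqP => _; rewrite ?addn1 ?expnS ?addn0 //; lia.
by rewrite mulnDr mulSn addnC leq_add2r.
Qed.

(* (1 + 1/q)^r <= 1 / (1 - r/q) *)
Lemma compound_growth (q r : nat) :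
  r <= q -> q.+1 ^ r * (q - r) <= q ^ r.+1.
Proof.
elim: r => [|r IH] rq; first by rewrite expn0 mul1n subn0 expn1.
have {}IH := IH (ltnW rq).
rewrite expnSr -mulnA [q ^ r.+2]expnSr.
apply: leq_trans (leq_mul IH (leqnn q)).
rewrite -mulnA leq_pmul2l ?expn_gt0 //.
have [d ->] : exists d, q = r.+1 + d by exists (q - r.+1); lia.
have -> : r.+1 + d - r.+1 = d by lia.
have -> : r.+1 + d - r = d.+1 by lia.
by lia.
Qed.

(** Since [4 * r <= q], (1 + 1/q)^r <= q/(q - r) <= 4/3, and the power 2K of this is (16/9)^K.
    Denominators are cleared to stay in [nat]. *)
Lemma growth_le (q r K j : nat) :
  0 < r -> 4 * r <= q -> j <= 2 * r * K -> 9 ^ K * q.+1 ^ j <= 16 ^ K * q ^ j.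
Proof.
move=> r0 rq jm.
have q0 : 0 < q by lia.
have H1 : 3 * q.+1 ^ r <= 4 * q ^ r.
  have := compound_growth (_ : r <= q); rewrite expnS => /(_ ltac:(lia)) H.
  rewrite -(leq_pmul2l q0) [X in _ <= X]mulnCA.
  apply: leq_trans (leq_mul (leqnn 4) H).
  rewrite mulnA mulnCA mulnC leq_mul2l expn_eq0 /=; lia.
have H2 : 9 ^ K * q.+1 ^ (2 * r * K) <= 16 ^ K * q ^ (2 * r * K).
  have E a b : (a ^ 2) ^ K * b ^ (2 * r * K) = (a * b ^ r) ^ (2 * K).
    by rewrite expnMn -!expnM; congr (_ * b ^ _); lia.
  by rewrite !(E 3) !(E 4); case: K {jm E} => // K; rewrite leq_exp2r.
(* The case of [j] below [m] reduces to [j = m]: the missing factors q^(m - j) are at most (q +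
   1)^(m - j). *)
move: jm H2; set m := 2 * r * K => jm H2.
have qq : q ^ (m - j) <= q.+1 ^ (m - j) by case: (_ - _) => [|k] //;
  rewrite leq_exp2r.
have q'0 : 0 < q ^ (m - j) by rewrite expn_gt0 q0.
rewrite -(leq_pmul2r q'0).
rewrite -!mulnA -expnD subnKC //; apply: leq_trans H2.
by rewrite leq_mul2l -{2}(subnKC jm) expnD leq_mul2l qq !orbT.
Qed.

(** A start of at most 2^K times a growth of at most (16/9)^K gives (32/9)^K. *)
Lemma potential_le (q r K : nat) (Ls : seq (nat -> nat)) :
  0 < r -> 4 * r <= q -> size Ls <= 2 * r * K ->
  q ^ size Ls * potential Ls (2 ^ K) <= q.+1 ^ size Ls * 2 ^ K ->
  9 ^ K * potential Ls (2 ^ K) <= 32 ^ K.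
Proof.
move=> r0 rq Hs Hp; have q0 : 0 < q by lia.
have q'0 : 0 < q ^ size Ls by rewrite expn_gt0 q0.
rewrite -(leq_pmul2l q'0) mulnCA.
apply: leq_trans (leq_mul (leqnn _) Hp) _.
rewrite mulnA; apply: leq_trans (leq_mul (growth_le r0 rq Hs) (leqnn _)) _.
by rewrite -[32]/(16 * 2) expnMn mulnA (mulnC (q ^ _)).
Qed.

(** A [z] killed 2K times would contribute 4^K to the potential on its own, so that 36^K <= 32^K,
    which is false for K > 0. *)
Lemma zeros_lt (K : nat) (Ls : seq (nat -> nat)) (z : nat) :
  9 ^ K * potential Ls (2 ^ K) <= 32 ^ K -> 0 < z < 2 ^ K ->
  zeros Ls z < 2 * K.
Proof.
move=> Hp /andP[z0 zK]; rewrite ltnNge; apply/negP => Hz.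
have K0 : 0 < K by case: K zK {Hp Hz} => //; rewrite expn0; lia.
have : 2 ^ zeros Ls z <= potential Ls (2 ^ K).
  by rewrite /potential
    (bigD1_seq z) ?mem_index_iota ?iota_uniq ?z0 //= leq_addr.
have : 2 ^ (2 * K) <= 2 ^ zeros Ls z by rewrite leq_exp2l.
rewrite expnM => H1 H2;
  have := leq_trans (leq_mul (leqnn (9 ^ K)) (leq_trans H1 H2)) Hp.
by rewrite -expnMn leq_exp2r.
Qed.

(** * The fibers of the maps as a selective family *)

Definition fiber (n : nat) (L : nat -> nat) (v : nat) : {set 'I_n} :=
  [set u : 'I_n | L u == v].

Definition fibers (n q : nat) (Ls : seq (nat -> nat)) : seq {set 'I_n} :=
  flatten [seq [seq fiber n L v | v <- iota 0 q] | L <- Ls].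

(** Double counting the collisions of [x] with the rest of [A] yields a map that separates [x] from
    all other elements; its fiber through [x] selects [x]. *)
Lemma fibers_strongly_selective (n r K q : nat) (Ls : seq (nat -> nat))
    (F : {set {set 'I_n}}) :
  0 < r -> n < 2 ^ K -> size Ls = 2 * r * K ->
  (forall j, j < size Ls -> xor_linear K (nth id Ls j) /\
     forall z, z < 2 ^ K -> nth id Ls j z < q) ->
  (forall z, 0 < z < 2 ^ K -> zeros Ls z < 2 * K) ->
  {subset fibers n q Ls <= F} -> strongly_selective n r F.
Proof.
move=> r0 nK sz HL Hz sF A cA x xA.
have bnd (u : 'I_n) : u < 2 ^ K by apply: ltn_trans nK.
have K0 : 0 < K by case: K nK {sz HL Hz bnd} => //; have := ltn_ord x;
  rewrite expn0; lia.
have [j Hj] : exists j : 'I_(size Ls), forall y, y \in A :\ x ->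
  nth id Ls j x != nth id Ls j y.
  suff /existsP[j /forallP Hj] : [exists j : 'I_(size Ls),
      forall (y | y \in A :\ x), nth id Ls j x != nth id Ls j y].
    by exists j => y yA; have := Hj y; rewrite yA.
  (* Otherwise each of the 2rK maps accounts for at least one collision. *)
  apply: contraT; rewrite negb_exists => /forallP H.
  have {}H (j : 'I_(size Ls)) : 1 <= \sum_(y in A :\ x)
    (nth id Ls j x == nth id Ls j y).
    have := H j; rewrite negb_forall => /existsP[y];
      rewrite negb_imply negbK => /andP[yA /eqP e].
    by rewrite (bigD1 y) //= e eqxx.
  have : size Ls <= \sum_(y in A :\ x) zeros Ls (xor x y).
    have -> : \sum_(y in A :\ x) zeros Ls (xor x y) =
       \sum_(j < size Ls) \sum_(y in A :\ x) (nth id Ls j x == nth id Ls j y).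
      rewrite [RHS]exchange_big /=; apply: eq_bigr => y _.
      rewrite /zeros (big_nth id) big_mkord; apply: eq_bigr => j _.
      have [li _] := HL j (ltn_ord j); rewrite (xor_linearP li) //;
        congr (nat_of_bool _).
      apply/eqP/eqP => [/PeanoNat.Nat.lxor_eq //|->].
      by rewrite PeanoNat.Nat.lxor_nilpotent.
    by apply: leq_trans (leq_sum _ (fun j _ => H j));
      rewrite sum1_card card_ord.
  have : \sum_(y in A :\ x) zeros Ls (xor x y) <= \sum_(y in A :\ x) (2 * K).-1.
    apply: leq_sum => y; rewrite !inE => /andP[yx _].
    have xy0 : xor x y != 0 :> nat.
      by apply: contra yx => /eqP /PeanoNat.Nat.lxor_eq e; apply/eqP/val_inj.
    by have := Hz (xor x y); rewrite xor_lt // andbT lt0n xy0 => /(_ isT); lia.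
  have := cardsD1 x A; rewrite xA cA sum_nat_const sz => ->.
  (* With k = r - 1, the two bounds give 2(k + 1)K <= k(2K - 1), which is false as K > 0. *)
  by move: #|_| => k; nia.
exists (fiber n (nth id Ls j) (nth id Ls j x)).
  apply: sF; apply/flattenP.
  exists [seq fiber n (nth id Ls j) v | v <- iota 0 q].
    by rewrite -(nth_map _ [::]
      (fun L => [seq fiber n L v | v <- iota 0 q])) ?mem_nth ?size_map.
  by apply: map_f; rewrite mem_iota add0n; case: (HL j (ltn_ord j)) => _ ->.
apply/setP => y; rewrite !inE; apply/andP/eqP => [[yA /eqP e]|->];
  last by rewrite eqxx.
apply/eqP; apply: contraT => yx; have := Hj y; rewrite !inE yx yA e eqxx.
by move=> /(_ isT).
Qed.

(** * Execution rules *)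

(* Eight arrays are interleaved in the memory: entry i of array t is at address
   8 i + t. *)
Local Notation arr s t i := (memory s (i * 8 + t)).
Local Notation idx t e := (Bin OAdd (Bin OMul e (Lit 8)) (Lit t)).
Local Notation get t e := (Fetch (idx t e)).

(* The value of an expression when no word overflows, which [fits] ensures. *)
Fixpoint evn (s : state) (e : expr) : nat :=
  match e with
  | Lit k => k
  | Reg x => regs s x
  | Fetch e1 => memory s (evn s e1)
  | Bin o e1 e2 => eval_binop o (evn s e1) (evn s e2)
  end.

Fixpoint fits (U : nat) (s : state) (e : expr) : bool :=
  match e with
  | Lit k => k < U
  | Reg x => true
  | Fetch e1 => fits U s e1
  | Bin o e1 e2 =>
      [&& fits U s e1, fits U s e2 & eval_binop o (evn s e1) (evn s e2) < U]
  end.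

Lemma evalE (w : nat) (s : state) (e : expr) :
  fits (2 ^ w) s e -> eval w s e = evn s e.
Proof.
elim: e => //= [k|e IH|o e1 IH1 e2 IH2]; first by move/modn_small.
  by move/IH->.
by case/and3P => /IH1-> /IH2-> /modn_small.
Qed.

Fixpoint wregs (p : cmd) : seq nat :=
  match p with
  | Assign x _ => [:: x]
  | Seq p q => wregs p ++ wregs q
  | If _ p q => wregs p ++ wregs q
  | While _ p => wregs p
  | _ => [::]
  end.

(** A syntactic over-approximation: an address not of the form 8e + t with a literal t < 8 counts as
    a store into every array. *)
Fixpoint wtags (p : cmd) : seq nat :=
  match p with
  | Store (Bin OAdd (Bin OMul _ (Lit k)) (Lit t)) _ =>
      if (k == 8) && (t < 8) then [:: t] else iota 0 8
  | Store _ _ => iota 0 8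
  | Seq p q => wtags p ++ wtags q
  | If _ p q => wtags p ++ wtags q
  | While _ p => wtags p
  | _ => [::]
  end.

Fixpoint writes_tape (p : cmd) : bool :=
  match p with
  | Output _ => true
  | Seq p q => writes_tape p || writes_tape q
  | If _ p q => writes_tape p || writes_tape q
  | While _ p => writes_tape p
  | _ => false
  end.

(* Array t occupies the addresses congruent to t modulo 8, so a store into one
   array leaves the others alone even when its address overflows. *)
Definition frame (p : cmd) (s s' : state) : Prop :=
  [/\ forall x, x \notin wregs p -> regs s' x = regs s x,
      forall t i, t < 8 -> t \notin wtags p -> arr s' t i = arr s t i
    & ~~ writes_tape p -> tape s' = tape s].

Lemma frame_refl (p : cmd) (s : state) : frame p s s.
Proof. by []. Qed.

Lemma frame_trans (p : cmd) (s1 s2 s3 : state) :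
  frame p s1 s2 -> frame p s2 s3 -> frame p s1 s3.
Proof.
move=> [r1 a1 o1] [r2 a2 o2]; split=> [x xp|t i t8 tp|np].
- by rewrite r2 ?r1.
- by rewrite a2 ?a1.
- by rewrite o2 ?o1.
Qed.

(** For [3 <= w], 8 divides [2 ^ w], so the reduction of an address modulo [2 ^ w] keeps its residue
    modulo 8 and hence its array. *)
Lemma exec_frame (w : nat) (p : cmd) (s : state) (t : nat) (s' : state) :
  3 <= w -> exec w p s t s' -> frame p s s'.
Proof.
move=> w3; have d8 : 8 %| 2 ^ w by rewrite -[8]/(2 ^ 3) dvdn_exp2l.
elim=> {p s t s'} //.
- move=> x e s; split=> //= y; rewrite inE /upd => /negPf-> //.
- move=> a e s; split=> // t i t8 /= H.
  rewrite /upd; case: eqP => // E; exfalso; move: H; apply/negP; rewrite negbK.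
  have D : t \in iota 0 8 by rewrite mem_iota.
  move: E; case: a => // [[] //] [] // [] // b [] // k [] // l /=.
  case: eqP => //= -> E; case: ifP => // l8; rewrite inE; apply/eqP.
  move/(congr1 (modn^~ 8)): E;
    rewrite modnMDl !modn_dvdm // (modn_small t8) => ->.
  rewrite -modnDm !modn_dvdm // -modnMm
    (modn_dvdm _ d8) modnn muln0 mod0n add0n.
  by rewrite modn_mod modn_small.
- move=> p q s s1 s2 t1 t2 _ [r1 a1 o1] _ [r2 a2 o2].
  split=> [x|t i t8|] /=; rewrite ?mem_cat negb_or => /andP[pp qq].
  + by rewrite r2 ?r1.
  + by rewrite a2 ?a1.
  + by rewrite o2 ?o1.
- move=> e p q s s1 t _ _ [r1 a1 o1].
  split=> [x|k i t8|] /=; rewrite ?mem_cat negb_or => /andP[pp qq]; auto.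
- move=> e p q s s1 t _ _ [r1 a1 o1].
  split=> [x|k i t8|] /=; rewrite ?mem_cat negb_or => /andP[pp qq]; auto.
- move=> e p s s1 s2 t1 t2 _ _ f1 _; exact: (@frame_trans (While e p)).
Qed.

(** * Total correctness with a time bound *)

Definition runs (w : nat) (p : cmd) (s : state) (b : nat) (Q : state -> Prop)
    : Prop :=
  exists t s', [/\ exec w p s t s', t <= b & Q s'].

Section Rules.
Variable w : nat.
Hypothesis w3 : 3 <= w.

(** The frame of [p] comes for free here, so specifications need to mention only what changes. *)
Lemma runs_weaken p s b b' (Q Q' : state -> Prop) :
  runs w p s b Q -> b <= b' -> (forall s', frame p s s' -> Q s' -> Q' s') ->
  runs w p s b' Q'.
Proof.
move=> [t [s' [E tb q]]] bb H; exists t, s'; split=> //;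
  first exact: leq_trans bb.
by apply: H q; apply: exec_frame E.
Qed.

Lemma runs_skip s b (Q : state -> Prop) : 0 < b -> Q s -> runs w Skip s b Q.
Proof. by exists 1, s; split=> //; constructor. Qed.

Lemma runs_assign x e s b (Q : state -> Prop) :
  fits (2 ^ w) s e -> cost e < b ->
  Q (State (upd (regs s) x (evn s e)) (memory s) (tape s)) ->
  runs w (Assign x e) s b Q.
Proof. by move=> /evalE E cb q; do 2 eexists; split;
  [constructor| |rewrite E]. Qed.

Lemma runs_store a e s b (Q : state -> Prop) :
  fits (2 ^ w) s a -> fits (2 ^ w) s e -> cost a + cost e < b ->
  Q (State (regs s) (upd (memory s) (evn s a) (evn s e)) (tape s)) ->
  runs w (Store a e) s b Q.
Proof.
by move=> /evalE E1 /evalE E2 cb q; do 2 eexists; split;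
  [constructor| |rewrite E1 E2].
Qed.

Lemma runs_output e s b (Q : state -> Prop) :
  fits (2 ^ w) s e -> cost e < b ->
  Q (State (regs s) (memory s) (rcons (tape s) (evn s e))) ->
  runs w (Output e) s b Q.
Proof. by move=> /evalE E cb q; do 2 eexists; split;
  [constructor| |rewrite E]. Qed.

Lemma runs_seq p q s b1 b2 b (Q : state -> Prop) :
  runs w p s b1 (fun s1 => runs w q s1 b2 Q) -> b1 + b2 <= b ->
  runs w (Seq p q) s b Q.
Proof.
move=> [t1 [s1 [E1 h1 [t2 [s2 [E2 h2 q2]]]]]] bb.
exists (t1 + t2), s2; split=> //; first exact: ESeq E1 E2.
exact: leq_trans (leq_add h1 h2) bb.
Qed.

Lemma runs_if e p q s b1 b (Q : state -> Prop) :
  fits (2 ^ w) s e -> (cost e).+1 + b1 <= b ->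
  (evn s e != 0 -> runs w p s b1 Q) -> (evn s e = 0 -> runs w q s b1 Q) ->
  runs w (If e p q) s b Q.
Proof.
move=> /evalE E bb Hp Hq; have [e0|e0] := eqVneq (evn s e) 0.
  have [t [s' [Ex tb q']]] := Hq e0; exists ((cost e).+1 + t), s'; split=> //.
    by apply: EIfFalse Ex; rewrite E.
  by apply: leq_trans bb; rewrite leq_add2l.
have [t [s' [Ex tb q']]] := Hp e0; exists ((cost e).+1 + t), s'; split=> //.
  by apply: EIfTrue Ex; rewrite E.
by apply: leq_trans bb; rewrite leq_add2l.
Qed.

Lemma runs_while0 e p s b (Q : state -> Prop) :
  fits (2 ^ w) s e -> evn s e = 0 -> cost e < b -> Q s ->
  runs w (While e p) s b Q.
Proof.
move=> /evalE E e0 cb q; exists (cost e).+1, s; split=> //.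
by constructor; rewrite E.
Qed.

Lemma runs_whileS e p s b1 b2 b (Q : state -> Prop) :
  fits (2 ^ w) s e -> evn s e != 0 -> (cost e).+1 + b1 + b2 <= b ->
  runs w p s b1 (fun s1 => runs w (While e p) s1 b2 Q) ->
  runs w (While e p) s b Q.
Proof.
move=> /evalE E e0 bb [t1 [s1 [E1 h1 [t2 [s2 [E2 h2 q2]]]]]].
exists ((cost e).+1 + t1 + t2), s2; split=> //.
  by apply: EWhileTrue E1 E2; rewrite E.
by apply: leq_trans bb; rewrite !addSn ltnS leq_add // leq_add2l.
Qed.

(** The invariant is indexed by the number of rounds done, and round [i] has its own budget [c i],
    which allows amortized and geometric time bounds. The frame always refers back to the state
    before the loop. *)
Lemma runs_loop (I : nat -> state -> Prop) (k : nat) (c : nat -> nat) e p s b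
    (Q : state -> Prop) :
  I 0 s ->
  (forall i s', i <= k -> frame p s s' -> I i s' ->
     fits (2 ^ w) s' e /\ (evn s' e != 0) = (i < k)) ->
  (forall i s', i < k -> frame p s s' -> I i s' ->
    runs w p s' (c i) (I i.+1)) ->
  \sum_(i < k) (c i + (cost e).+1) + (cost e).+1 <= b ->
  (forall s', frame p s s' -> I k s' -> Q s') ->
  runs w (While e p) s b Q.
Proof.
move=> I0 He Hp Hb HQ.
(* Induction on the number [d] of rounds that remain. *)
suff H : forall d i s', i + d = k -> frame p s s' -> I i s' ->
    runs w (While e p) s' (\sum_(i <= j < k) (c j + (cost e).+1) +
      (cost e).+1) Q.
  have := H k 0 s erefl (frame_refl _ _) I0; rewrite big_mkord => R.
  exact: runs_weaken R Hb _.
elim=> [|d IH] i s' id fs Ii.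
  have [f1 f2] := He i s' ltac:(lia) fs Ii.
  have ik : i = k by lia.
  apply: runs_while0 => //; first by apply/eqP;
    rewrite -[_ == _]negbK f2 ik ltnn.
    by rewrite leq_addl.
  by apply: HQ; rewrite -?ik.
have ik : i < k by lia.
have [f1 f2] := He i s' (ltnW ik) fs Ii.
apply: (runs_whileS (b1 := c i)
  (b2 := \sum_(i.+1 <= j < k) (c j + (cost e).+1) + (cost e).+1)) => //.
- by rewrite f2.
- by rewrite [X in _ <= X + _]big_ltn // addnA (addnC (c i)).
apply: runs_weaken (Hp i s' ik fs Ii) (leqnn _) _ => s1 f Ii1.
by apply: IH => //; [lia | apply: frame_trans f].
Qed.

Lemma runs_loop_const (I : nat -> state -> Prop) (k c : nat) e p s b
    (Q : state -> Prop) :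
  I 0 s ->
  (forall i s', i <= k -> frame p s s' -> I i s' ->
     fits (2 ^ w) s' e /\ (evn s' e != 0) = (i < k)) ->
  (forall i s', i < k -> frame p s s' -> I i s' -> runs w p s' c (I i.+1)) ->
  k * (c + (cost e).+1) + (cost e).+1 <= b ->
  (forall s', frame p s s' -> I k s' -> Q s') ->
  runs w (While e p) s b Q.
Proof.
move=> I0 He Hp Hb; apply: (runs_loop I0 He Hp).
by rewrite sum_nat_const card_ord.
Qed.

End Rules.

Lemma upd_arr (m : nat -> nat) (t t' i j v : nat) :
  t < 8 -> t' < 8 ->
  upd m (i * 8 + t) v (j * 8 + t') =
    if (t == t') && (i == j) then v else m (j * 8 + t').
Proof.
move=> t8 t8'; rewrite /upd.
suff -> : (j * 8 + t' == i * 8 + t) = (t == t') && (i == j) by [].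
lia.
Qed.

(** * Choosing a map *)

Local Notation rn := 0 (only parsing).
Local Notation rr := 1 (only parsing).
Local Notation rK := 2 (only parsing).
Local Notation rN := 3 (only parsing).
Local Notation rS := 4 (only parsing).
Local Notation rG := 5 (only parsing).
Local Notation rq := 6 (only parsing).
Local Notation rj := 7 (only parsing).
Local Notation rP := 8 (only parsing).
Local Notation rz := 9 (only parsing).
Local Notation ra := 10 (only parsing).
Local Notation rv := 11 (only parsing).
Local Notation ry := 12 (only parsing).

(* xor table, weights of the z, current map, buckets, heads and links of the
   lists of the sets *)
Local Notation aX := 0 (only parsing).
Local Notation aW := 1 (only parsing).
Local Notation aL := 2 (only parsing).
Local Notation aB := 3 (only parsing).
Local Notation aH := 4 (only parsing).
Local Notation aC := 5 (only parsing).

Declare Scope prog_scope.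
Delimit Scope prog_scope with prog.
Local Notation "# x" := (Reg x) (at level 2, format "# x") : prog_scope.
Local Notation "$ k" := (Lit k) (at level 2, format "$ k") : prog_scope.
Local Notation "x <~ e" := (Assign x e) (at level 65) : prog_scope.
Local Notation "p ;; q" := (Seq p q)
  (at level 68, right associativity) : prog_scope.
Local Notation "x + y" := (Bin OAdd x y) : prog_scope.
Local Notation "x - y" := (Bin OSub x y) : prog_scope.
Local Notation "x * y" := (Bin OMul x y) : prog_scope.
Local Notation "x / y" := (Bin ODiv x y) : prog_scope.
Local Notation "x % y" := (Bin OMod x y) (at level 40) : prog_scope.
Local Notation "x < y" := (Bin OLt x y) : prog_scope.
Local Notation "x == y" := (Bin OEq x y) : prog_scope.
Arguments Assign x e%_prog.
Arguments Store a%_prog e%_prog.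
Arguments Output e%_prog.
Arguments Fetch e%_prog.
Arguments Seq p%_prog q%_prog.
Arguments If e%_prog p%_prog q%_prog.
Arguments While e%_prog p%_prog.
Arguments Bin o x%_prog y%_prog.

Definition incr (x : nat) : cmd := (x <~ #x + $1)%prog.

Lemma leq_sum_ord (i k : nat) (F : nat -> nat) :
  i <= k -> \sum_(z < i) F z <= \sum_(z < k) F z.
Proof.
move=> ik; rewrite -!(big_mkord xpredT F) (@big_cat_nat _ _ _ i 0 k) //=.
exact: leq_addr.
Qed.

Section Straight.
Variable w : nat.
Hypothesis w3 : 3 <= w.

(** The remaining budget is computed by subtraction, so straight-line code is executed symbolically
    without naming intermediate bounds. *)
Lemma seq_assign x e q s b (Q : state -> Prop) :
  fits (2 ^ w) s e -> cost e < b ->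
  runs w q (State (upd (regs s) x (evn s e)) (memory s) (tape s))
    (b - (cost e).+1) Q ->
  runs w (Seq (Assign x e) q) s b Q.
Proof.
move=> fe cb H; apply: (runs_seq (b1 := (cost e).+1) (b2 := b - (cost e).+1)).
  exact: runs_assign.
by rewrite subnKC.
Qed.

Lemma seq_store a e q s b (Q : state -> Prop) :
  fits (2 ^ w) s a -> fits (2 ^ w) s e -> cost a + cost e < b ->
  runs w q (State (regs s) (upd (memory s) (evn s a) (evn s e)) (tape s))
    (b - (cost a + cost e).+1) Q ->
  runs w (Seq (Store a e) q) s b Q.
Proof.
move=> fa fe cb H.
apply: (runs_seq (b1 := (cost a + cost e).+1) (b2 := b - (cost a + cost e).+1)).
  exact: runs_store.
by rewrite subnKC.
Qed.

Lemma seq_output e q s b (Q : state -> Prop) :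
  fits (2 ^ w) s e -> cost e < b ->
  runs w q (State (regs s) (memory s) (rcons (tape s) (evn s e)))
    (b - (cost e).+1) Q ->
  runs w (Seq (Output e) q) s b Q.
Proof.
move=> fe cb H; apply: (runs_seq (b1 := (cost e).+1) (b2 := b - (cost e).+1)).
  exact: runs_output.
by rewrite subnKC.
Qed.

Definition fill (t lim c : nat) : cmd :=
  (rv <~ $0 ;;
   While (#rv < #lim) (Store (idx t #rv) $c ;; incr rv))%prog.

Lemma fillP t lim c s k b :
  t < 8 -> lim != rv -> c < 2 ^ w -> regs s lim = k -> k * 8 + 8 <= 2 ^ w ->
  k * 20 + 20 <= b ->
  runs w (fill t lim c) s b (fun s' => forall i, i < k -> arr s' t i = c).
Proof.
move=> t8 lv cw sk kw kb; apply: seq_assign => //=; first by lia.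
  by lia.
apply: (@runs_loop_const w w3 (fun i s' => regs s' rv = i /\
   forall j, j < i -> arr s' t j = c) k 15) => //=.
- move=> i s' ik [fR fA fT] [iv H].
  have e : regs s' lim = k by rewrite fR /= ?inE // /upd /= (negPf lv).
  by rewrite iv e; split; lia.
- move=> i s' ik _ [iv H].
  apply: seq_store => //=; first by rewrite iv; lia.
  apply: runs_assign => //=; first by rewrite iv; lia.
  rewrite {1}/upd /= iv addn1; split=> // j ji; rewrite upd_arr // eqxx /=.
  by case: eqP => // ne; apply: H; lia.
- by rewrite /cost; lia.
- by move=> s' _ [].
Qed.

(** Here P = 2^i, and bucket v receives the weight of the P + z that die if v is chosen as the image
    of P. *)
Definition prog_buckets : cmd :=
  (rz <~ $0 ;;
   While (#rz < #rP)
     (Store (idx aB (get aL #rz)) (get aB (get aL #rz) + get aW (#rP + #rz)) ;;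
      incr rz))%prog.

Lemma prog_bucketsP s P q b :
  regs s rP = P -> (P + P) * 8 + 8 <= 2 ^ w -> q * 8 + 8 <= 2 ^ w ->
  (forall z, z < P -> arr s aL z < q) -> (forall v, v < q -> arr s aB v = 0) ->
  \sum_(z < P) arr s aW (P + z) < 2 ^ w -> P * 50 + 50 <= b ->
  runs w prog_buckets s b (fun s' => forall v, v < q ->
    arr s' aB v = \sum_(z < P) (arr s aL z == v) * arr s aW (P + z)).
Proof.
move=> eP Pw qw HL HB HW Pb; apply: seq_assign => //=; [lia|lia|].
apply: (@runs_loop_const w w3 (fun i s' => regs s' rz = i /\
   forall v, v < q ->
    arr s' aB v =
      \sum_(z < i) (arr s aL z == v) * arr s aW (P + z)) P 40) => //=.
- by split=> // v vq; rewrite big_ord0 HB.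
- move=> i s' ik [fR fA fT] [iz H].
  by rewrite iz fR //= /upd /= eP; split; lia.
- move=> i s' ik [fR fA fT] [iz H].
  have eP' : regs s' rP = P by rewrite fR.
  have eW j : arr s' aW j = arr s aW j by rewrite fA.
  have eL j : arr s' aL j = arr s aL j by rewrite fA.
  have Lq := HL i ik.
  (* A bucket never exceeds the total weight of the block, so the addition does not overflow. *)
  have bd : arr s' aB (arr s aL i) + arr s aW (P + i) < 2 ^ w.
    apply: leq_ltn_trans HW.
    apply: leq_trans (leq_sum_ord (fun z => arr s aW (P + z)) ik).
    rewrite H // big_ord_recr leq_add2r; apply: leq_sum => z _.
    by case: (_ == _); rewrite ?mul1n.
  apply: seq_store => //=; rewrite ?iz ?eP' ?eL ?eW; [lia|lia|].
  apply: runs_assign => //=; first by rewrite iz; lia.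
  rewrite {1}/upd /= iz addn1; split=> // v vq;
    rewrite upd_arr //= big_ord_recr /= -H //.
  by case: eqP => [->|]; rewrite ?mul1n ?mul0n ?addn0.
- by rewrite /cost; lia.
- by move=> s' _ [].
Qed.

Definition prog_argmin : cmd :=
  (ra <~ $0 ;; rv <~ $1 ;;
   While (#rv < #rq)
     (If (get aB #rv < get aB #ra) (ra <~ #rv) Skip ;; incr rv))%prog.

Lemma prog_argminP s q b :
  regs s rq = q -> 0 < q -> q * 8 + 8 <= 2 ^ w -> q * 50 + 50 <= b ->
  runs w prog_argmin s b (fun s' => regs s' ra < q /\
    forall v, v < q -> arr s aB (regs s' ra) <= arr s aB v).
Proof.
move=> eq q0 qw qb; apply: seq_assign => //=; [lia|lia|].
apply: seq_assign => //=; [lia|lia|].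
(* Bucket 0 is the first candidate, so the scan starts at 1 and takes [q.-1] rounds. *)
apply: (@runs_loop_const w w3 (fun i s' => [/\ regs s' rv =
  i.+1, regs s' ra <= i &
   forall v, v <= i -> arr s aB (regs s' ra) <= arr s aB v]) q.-1 40) => //=.
- by split=> // v; rewrite leqn0 => /eqP->.
- move=> i s' ik [fR fA fT] [iv _ H].
  by rewrite iv fR //= /upd /= eq; split; lia.
- move=> i s' ik [fR fA fT] [iv ai H].
  have eB j : arr s' aB j = arr s aB j by rewrite fA.
  apply: (runs_seq (b1 := 20) (b2 := 20)) => //.
  have Q s1 : regs s1 rv = i.+1 -> regs s1 ra <= i.+1 ->
     (forall v, v <= i.+1 -> arr s aB (regs s1 ra) <= arr s aB v) ->
     runs w (incr rv) s1 20 (fun s2 => [/\ regs s2 rv =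
       i.+2, regs s2 ra <= i.+1 &
        forall v, v <= i.+1 -> arr s aB (regs s2 ra) <= arr s aB v]).
    move=> h1 h2 h3; apply: runs_assign => //=; first by rewrite h1; lia.
    by rewrite /upd /= h1 addn1.
  apply: (runs_if (b1 := 5)) => //=; rewrite ?iv ?eB; first by lia.
    move=> lt; apply: runs_assign => //; apply: Q; rewrite /upd /= iv //.
    move=> v; rewrite leq_eqVlt => /orP[/eqP-> //|/ltnSE /H]; lia.
  move=> lt; apply: runs_skip => //; apply: Q => //; first by lia.
  move=> v; rewrite leq_eqVlt => /orP[/eqP->|/ltnSE /H //]; lia.
- by rewrite /cost; lia.
- by move=> s' _ [_ h1 h2]; split; [lia | move=> v vq; apply: h2; lia].
Qed.

(** The xor of [ra] and L z is read from the table, whose entry for (u, v) has index uq + v. The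
    round z = 0 stores the image of P itself. *)
Definition prog_extend : cmd :=
  (rz <~ $0 ;;
   While (#rz < #rP)
     (Store (idx aL (#rP + #rz)) (get aX (#ra * #rq + get aL #rz)) ;;
      If (get aL (#rP + #rz) == $0)
        (Store (idx aW (#rP + #rz)) (get aW (#rP + #rz) * $2)) Skip ;;
      incr rz))%prog.

Lemma prog_extendP s P q a b :
  regs s rP = P -> regs s rq = q -> regs s ra = a -> a < q ->
  (P + P) * 8 + 8 <= 2 ^ w -> q * q * 8 + 8 <= 2 ^ w ->
  (forall z, z < P -> arr s aL z < q) ->
  (forall u v, u < q -> v < q -> arr s aX (u * q + v) = xor u v) ->
  (forall z, z < P -> arr s aW (P + z) * 2 < 2 ^ w) -> P * 100 + 50 <= b ->
  runs w prog_extend s b (fun s' => forall k,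
    arr s' aL k =
      (if P <= k < P + P then xor a (arr s aL (k - P)) else arr s aL k) /\
    arr s' aW k = (if (P <= k < P + P) && (xor a (arr s aL (k - P)) == 0)
      then arr s aW k * 2 else arr s aW k)).
Proof.
move=> eP eq ea aq Pw qw HL HX HW Pb; apply: seq_assign => //=; [lia|lia|].
apply: (@runs_loop_const w w3 (fun i s' => regs s' rz = i /\ forall k,
    arr s' aL k =
      (if P <= k < P + i then xor a (arr s aL (k - P)) else arr s aL k) /\
    arr s' aW k = (if (P <= k < P + i) && (xor a (arr s aL (k - P)) == 0)
      then arr s aW k * 2 else arr s aW k)) P 90) => //=.
- by split=> // k; rewrite addn0; split; case: ifP => //; lia.
- move=> i s' ik [fR fA fT] [iz H].
  by rewrite iz fR //= /upd /= eP; split; lia.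
- move=> i s' ik [fR fA fT] [iz H].
  have eP' : regs s' rP = P by rewrite fR.
  have eq' : regs s' rq = q by rewrite fR.
  have ea' : regs s' ra = a by rewrite fR.
  have eX u v : u < q -> v < q -> arr s' aX (u * q + v) = xor u v.
    by move=> uq vq; rewrite fA // HX.
  have Lq := HL i ik.
  have eL : arr s' aL i = arr s aL i by rewrite (H i).1; case: ifP => //; lia.
  have ad : a * q + arr s aL i < q * q by nia.
  have eLi := eX _ _ aq Lq.
  have xq : xor a (arr s aL i) < 2 ^ w.
    have aw : a < 2 ^ w by nia.
    have lw : arr s aL i < 2 ^ w by nia.
    exact: xor_lt.
  have eW : arr s' aW (P + i) = arr s aW (P + i).
    by rewrite (H (P + i)).2; case: ifP => //; lia.
  have Wi := HW i ik.
  apply: seq_store => //=; rewrite ?iz ?eP' ?ea' ?eq' ?eL; [lia|lia|].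
  apply: (runs_seq (b1 := 40) (b2 := 10)) => //.
  (* The increment is common to both branches of the conditional and is treated once. *)
  have Q s1 : regs s1 rz = i -> (forall k,
     arr s1 aL k =
       (if P <= k < P + i.+1 then xor a (arr s aL (k - P)) else arr s aL k) /\
     arr s1 aW k = (if (P <= k < P + i.+1) && (xor a (arr s aL (k - P)) == 0)
      then arr s aW k * 2 else arr s aW k)) ->
     runs w (incr rz) s1 10 (fun s2 => regs s2 rz = i.+1 /\ forall k,
     arr s2 aL k =
       (if P <= k < P + i.+1 then xor a (arr s aL (k - P)) else arr s aL k) /\
     arr s2 aW k = (if (P <= k < P + i.+1) && (xor a (arr s aL (k - P)) == 0)
      then arr s aW k * 2 else arr s aW k)).
    move=> h1 h2; apply: runs_assign => //=; first by rewrite h1; lia.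
    by rewrite {1}/upd /= h1 addn1; split.
  have bd k : (P <= k < P + i.+1) = (P <= k < P + i) || (k == P + i) by lia.
  have kPi : P + i - P = i by lia.
  rewrite eLi; apply: (runs_if (b1 := 20)) => //=;
    rewrite iz eP' ?upd_arr //= ?eqxx /=.
  + by lia.
  + move=> x0; apply: runs_store => //=; rewrite ?iz ?eP' ?upd_arr //= ?eW;
    [lia|lia|].
    apply: Q => // k; rewrite /= !upd_arr //= bd; have [h1 h2] := H k.
    rewrite eq_sym; case: eqP => [->|_]; last by rewrite orbF.
    rewrite orbT kPi andTb; split => //.
    by move: x0; case: (xor _ _ == 0).
  + move=> x0; apply: runs_skip => //; apply: Q => // k.
    rewrite /= !upd_arr //= bd; have [h1 h2] := H k.
    rewrite eq_sym; case: eqP => [->|_]; last by rewrite orbF.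
    rewrite orbT kPi andTb; split => //.
    by move: x0; case: (xor _ _ == 0); rewrite ?eW.
- by rewrite /cost; lia.
- by move=> s' _ [].
Qed.

End Straight.

(** The lightest of [q] buckets weighs at most the average; each [z] lies in exactly one bucket, so
    the buckets add up to the total. *)
Lemma min_bucket (q P a : nat) (L f : nat -> nat) :
  (forall z, z < P -> L z < q) ->
  (forall v, v < q ->
    \sum_(z < P) (L z == a) * f z <= \sum_(z < P) (L z == v) * f z) ->
  q * (\sum_(z < P) (L z == a) * f z) <= \sum_(z < P) f z.
Proof.
move=> HL Ha; rewrite -[q in q * _]card_ord -sum_nat_const.
apply: leq_trans (leq_sum _ (fun (v : 'I_q) _ => Ha v (ltn_ord v))) _.
rewrite exchange_big leq_sum //= => z _.
rewrite (bigD1 (Ordinal (HL z (ltn_ord z)))) //= eqxx mul1n big1 ?addn0 // => v.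
by rewrite -val_eqE /= eq_sym => /negPf->.
Qed.

Lemma sum_ord_addl (a b : nat) (F : nat -> nat) :
  \sum_(z < b) F (a + z) = \sum_(a <= z < a + b) F z.
Proof.
rewrite -[X in _ = \sum_(X <= _ < _) _]add0n big_addn addKn big_mkord.
by apply: eq_bigr => z _; rewrite addnC.
Qed.

Section Column.
Variable w : nat.
Hypothesis w3 : 3 <= w.

Definition prog_bit : cmd :=
  (fill aB rq 0 ;; prog_buckets ;; prog_argmin ;; prog_extend ;;
    rP <~ #rP * $2)%prog.

(** One step of conditional expectations: the last clause says that the chosen image kills at most a
    fraction 1/q of the weight of the block [P, 2P). *)
Lemma prog_bitP s P q b :
  regs s rP = P -> regs s rq = q -> 0 < q ->
  (P + P) * 8 + 8 <= 2 ^ w -> q * q * 8 + 8 <= 2 ^ w ->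
  (forall z, z < P -> arr s aL z < q) ->
  (forall u v, u < q -> v < q -> arr s aX (u * q + v) = xor u v) ->
  (\sum_(z < P) arr s aW (P + z)) * 2 < 2 ^ w -> q * 70 + P * 150 + 200 <= b ->
  runs w prog_bit s b (fun s' => exists a, [/\ a < q,
    regs s' rP = P + P,
    forall k, arr s' aL k =
      (if P <= k < P + P then xor a (arr s aL (k - P)) else arr s aL k),
    forall k, arr s' aW k =
      (if (P <= k < P + P) && (xor a (arr s aL (k - P)) == 0)
       then arr s aW k * 2 else arr s aW k)
    & q * (\sum_(z < P) (arr s aL z == a) * arr s aW (P + z)) <=
        \sum_(z < P) arr s aW (P + z)]).
Proof.
move=> eP eq q0 Pw qw HL HX HW Hb.
have qq : q <= q * q by nia.
have W1 z : z < P -> arr s aW (P + z) * 2 < 2 ^ w.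
  move=> zP; apply: leq_ltn_trans HW; rewrite leq_pmul2r //.
  by rewrite (bigD1 (Ordinal zP)) //= leq_addr.
apply: (runs_seq (b1 := q * 20 + 20) (b2 := q * 50 + P * 150 + 180));
  last by lia.
apply: runs_weaken w3 _ _ _ _ _ _ (fillP w3 _ _ _ eq _ (leqnn _))
  (leqnn _) _ => //; [lia|lia|].
move=> s1 f1 H1; have [fR1 fA1 _] := f1.
have eP1 : regs s1 rP = P by rewrite fR1.
have eq1 : regs s1 rq = q by rewrite fR1.
have eL1 j : arr s1 aL j = arr s aL j by rewrite fA1.
have eW1 j : arr s1 aW j = arr s aW j by rewrite fA1.
have sW : \sum_(z < P) arr s1 aW (P + z) = \sum_(z < P) arr s aW (P + z).
  by apply: eq_bigr => z _; rewrite eW1.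
apply: (runs_seq (b1 := P * 50 + 50) (b2 := q * 50 + P * 100 + 130));
  last by lia.
apply: runs_weaken w3 _ _ _ _ _ _ (prog_bucketsP w3 (q :=
  q) eP1 Pw _ _ H1 _ (leqnn _)) (leqnn _) _.
- by lia.
- by move=> z zP; rewrite eL1 HL.
- by rewrite sW; lia.
move=> s2 f2 H2; have [fR2 fA2 _] := f2.
have eP2 : regs s2 rP = P by rewrite fR2.
have eq2 : regs s2 rq = q by rewrite fR2.
have eL2 j : arr s2 aL j = arr s aL j by rewrite fA2.
have eW2 j : arr s2 aW j = arr s aW j by rewrite fA2.
apply: (runs_seq (b1 := q * 50 + 50) (b2 := P * 100 + 80)); last by lia.
apply: runs_weaken w3 _ _ _ _ _ _ (prog_argminP w3 eq2 q0 _ (leqnn _))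
  (leqnn _) _; first by lia.
move=> s3 f3 [aq H3]; have [fR3 fA3 _] := f3.
have eP3 : regs s3 rP = P by rewrite fR3.
have eq3 : regs s3 rq = q by rewrite fR3.
have eL3 j : arr s3 aL j = arr s aL j by rewrite fA3.
have eW3 j : arr s3 aW j = arr s aW j by rewrite fA3.
apply: (runs_seq (b1 := P * 100 + 50) (b2 := 20)); last by lia.
apply: runs_weaken w3 _ _ _ _ _ _
  (prog_extendP w3 eP3 eq3 erefl aq Pw qw _ _ _ (leqnn _)) (leqnn _) _.
- by move=> z zP; rewrite eL3 HL.
- by move=> u v uq vq; rewrite fA3 // fA2 // fA1 // HX.
- by move=> z zP; rewrite eW3 W1.
move=> s4 f4 H4; have [fR4 fA4 _] := f4.
have eP4 : regs s4 rP = P by rewrite fR4.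
apply: runs_assign => //=; first by rewrite eP4; lia.
exists (regs s3 ra); split=> //=.
- by rewrite /upd /= eP4; lia.
- by move=> k; rewrite (H4 k).1 !eL3.
- by move=> k; rewrite (H4 k).2 !eL3 !eW3.
- apply: (@min_bucket q P (regs s3 ra) (fun z => arr s aL z)
  (fun z => arr s aW (P + z))) => // v vq.
  have E u : u < q ->
    arr s2 aB u = \sum_(z < P) (arr s aL z == u) * arr s aW (P + z).
    by move=> uq; rewrite H2 //; apply: eq_bigr => z _; rewrite eL1 eW1.
  by rewrite -!E // H3.
Qed.

Definition prog_column : cmd := (rP <~ $1 ;; While (#rP < #rN) prog_bit)%prog.

(** The blocks [2^i, 2^(i+1)) partition [1, 2^K), so the bounds 1/q on the blocks add up to the
    bound 1/q on the whole. *)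
Lemma prog_columnP s K q b :
  regs s rN = 2 ^ K -> regs s rq = q -> 0 < q ->
  2 ^ K * 8 + 8 <= 2 ^ w -> q * q * 8 + 8 <= 2 ^ w ->
  arr s aL 0 = 0 ->
  (forall u v, u < q -> v < q -> xor u v < q) ->
  (forall u v, u < q -> v < q -> arr s aX (u * q + v) = xor u v) ->
  (\sum_(1 <= z < 2 ^ K) arr s aW z) * 2 < 2 ^ w ->
  K * (q * 70 + 210) + 2 ^ K * 150 + 20 <= b ->
  runs w prog_column s b (fun s' => [/\
    xor_linear K (fun z => arr s' aL z),
    forall z, z < 2 ^ K -> arr s' aL z < q,
    forall z, 0 < z < 2 ^ K ->
      arr s' aW z = (if arr s' aL z == 0 then arr s aW z * 2 else arr s aW z)
    & q * (\sum_(1 <= z < 2 ^ K | arr s' aL z == 0) arr s aW z) <=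
        \sum_(1 <= z < 2 ^ K) arr s aW z]).
Proof.
move=> eN eq q0 Nw qw L0 Hq HX HW Hb.
apply: seq_assign => //=; [lia|lia|].
apply: (@runs_loop w w3 (fun i s' => [/\ regs s' rP = 2 ^ i,
  xor_linear i (fun z => arr s' aL z),
  forall z, z < 2 ^ i -> arr s' aL z < q,
  forall z, 0 < z -> arr s' aW z =
    (if (z < 2 ^ i) && (arr s' aL z == 0) then arr s aW z * 2 else arr s aW z)
  & q * (\sum_(1 <= z < 2 ^ i | arr s' aL z == 0) arr s aW z) <=
        \sum_(1 <= z < 2 ^ i) arr s aW z]) K
  (fun i => q * 70 + 2 ^ i * 150 + 200)) => //=.
- rewrite expn0; split=> //.
  + by move=> z; rewrite ltnS leqn0 => /eqP->; rewrite L0.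
  + by move=> z z0; case: ifP => // /andP[]; lia.
  + by rewrite !big_geq ?muln0.
- move=> i s' iK [fR fA fT] [iP _ _ _ _].
  have e : regs s' rN = 2 ^ K by rewrite fR.
  by rewrite iP e ltn_exp2l //; split; lia.
- move=> i s' iK [fR fA fT] [iP [L0' lin] Lq Ww pot].
  have pos : 0 < 2 ^ i by rewrite expn_gt0.
  have P2 : 2 ^ i + 2 ^ i = 2 ^ i.+1 by rewrite expnS; lia.
  have PK : 2 ^ i.+1 <= 2 ^ K by rewrite leq_exp2l.
  (* Earlier rounds changed weights below 2^i only. *)
  have Weq z : arr s' aW (2 ^ i + z) = arr s aW (2 ^ i + z).
    by rewrite Ww ?addn_gt0 ?pos //; case: ifP => // /andP[]; lia.
  have shift (F : nat -> nat) :
      \sum_(z < 2 ^ i) F (2 ^ i + z) = \sum_(2 ^ i <= z < 2 ^ i.+1) F z.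
    by rewrite -P2 sum_ord_addl.
  have cat (F : nat -> nat) : \sum_(1 <= z < 2 ^ i.+1) F z =
      \sum_(1 <= z < 2 ^ i) F z + \sum_(z < 2 ^ i) F (2 ^ i + z).
    by rewrite shift -big_cat_nat //= leq_exp2l.
  apply: runs_weaken w3 _ _ _ _ _ _ (prog_bitP iP _ q0 _ qw Lq _ _ (leqnn _))
    (leqnn _) _.
  + by rewrite fR.
  + by lia.
  + by move=> u v uq vq; rewrite fA // HX.
  + apply: leq_ltn_trans HW; rewrite leq_pmul2r //.
    have -> : \sum_(z < 2 ^ i) arr s' aW (2 ^ i + z) =
        \sum_(2 ^ i <= z < 2 ^ i.+1) arr s aW z.
      by rewrite -(shift (fun z => arr s aW z)); apply: eq_bigr => z _.
    rewrite [X in _ <= X](@big_cat_nat _ _ _ (2 ^ i.+1)) //=; last by lia.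
    by rewrite [X in _ <= X + _](@big_cat_nat _ _ _ (2 ^ i)) //=; lia.
  move=> s1 f1 [a [aq eP1 eL1 eW1 pot1]].
  have lo z : z < 2 ^ i -> arr s1 aL z = arr s' aL z.
    by move=> zi; rewrite eL1; case: ifP => //; lia.
  have hi z : z < 2 ^ i -> arr s1 aL (2 ^ i + z) = xor a (arr s' aL z).
    move=> zi; rewrite eL1; case: ifP => [_|]; last by lia.
    by congr (xor _ (arr _ _ _)); lia.
  have aE : arr s1 aL (2 ^ i) = a.
    by rewrite -[2 ^ i]addn0 hi // L0' PeanoNat.Nat.lxor_0_r.
  split.
  + by rewrite eP1.
  + split; first by rewrite lo.
    move=> j z; rewrite ltnS leq_eqVlt => /orP[/eqP->|ji] zj.
      by rewrite hi // aE lo.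
    have lji : 2 ^ j.+1 <= 2 ^ i by rewrite leq_exp2l.
    rewrite expnS in lji.
    by rewrite !lo ?lin //; lia.
  + move=> z; rewrite -P2 => zP; case: (ltnP z (2 ^ i)) => zi;
    first by rewrite lo ?Lq.
    have [y yE] : exists y, z = 2 ^ i + y by exists (z - 2 ^ i); lia.
    have yi : y < 2 ^ i by lia.
    by rewrite yE hi // Hq ?Lq.
  + move=> z z0; rewrite eW1 -P2; case: (ltnP z (2 ^ i)) => zi /=.
      have zPP : z < 2 ^ i + 2 ^ i by lia.
      by rewrite Ww // zPP zi lo.
    rewrite Ww // [z < 2 ^ i]ltnNge zi /=; case: (ltnP z) => //= zP.
    by rewrite -hi ?subnKC //; lia.
  + rewrite big_mkcond /= !cat mulnDr; apply: leq_add.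
      apply: leq_trans pot; rewrite leq_pmul2l // [X in _ <= X]big_mkcond /=.
      by rewrite !big_nat; apply: leq_sum => z /andP[_ zi]; rewrite lo.
    under [X in _ <= X]eq_bigr do rewrite -Weq.
    (* The image [xor a (L z)] of 2^i + z vanishes only if L z = a, so the killed weight of the
       block is at most that of bucket [a]. *)
    apply: leq_trans pot1; rewrite leq_pmul2l //; apply: leq_sum => z _.
    rewrite hi // Weq; case: eqP => // /PeanoNat.Nat.lxor_eq ->.
    by rewrite eqxx mul1n.
(* The block lengths form a geometric sum, which makes their total cost linear in 2^K. *)
- rewrite big_split big_split /= !sum_nat_const !card_ord.
  have -> : \sum_(i < K) (q * 70 + 2 ^ i * 150) =
    K * (q * 70) + (2 ^ K).-1 * 150.
    rewrite big_split /= sum_nat_const card_ord; congr (_ + _).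
    by rewrite -big_distrl predn_exp mul1n.
  have := expn_gt0 2 K; lia.
- move=> s' _ [_ h1 h2 h3 h4]; split=> // z /andP[z0 zK].
  by rewrite h3 // zK.
Qed.
End Column.

(** * Output of the sets and the xor table *)

Lemma upd_same (f : nat -> nat) (a v : nat) : upd f a v a = v.
Proof. by rewrite /upd eqxx. Qed.

(* Links are shifted by one, 0 being the null link. *)
Fixpoint chain (nx : nat -> nat) (y : nat) (l : seq nat) : Prop :=
  match l with
  | [::] => y = 0
  | x :: l' => y = x.+1 /\ chain nx (nx x) l'
  end.

Lemma eq_chain (nx nx' : nat -> nat) (y : nat) (l : seq nat) :
  (forall x, x \in l -> nx x = nx' x) -> chain nx y l -> chain nx' y l.
Proof.
elim: l y => //= x l IH y H [-> c]; split=> //.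
rewrite -H ?mem_head //; apply: IH c => z zl.
by apply: H; rewrite inE zl orbT.
Qed.

(** The output for one map in terms of plain numbers; [encode_fibers] relates it to sets of
    ordinals. *)
Definition column (n q : nat) (L : nat -> nat) : seq nat :=
  flatten [seq rcons [seq x.+1 | x <- iota 0 n & L x == v] 0 | v <- iota 0 q].

(** Each entry is counted for at most one [v]. This bounds the total length of the lists walked for
    one map. *)
Lemma sum_count_le (q : nat) (L : nat -> nat) (l : seq nat) :
  \sum_(v < q) count (fun x => L x == v) l <= size l.
Proof.
elim: l => [|x l IH] /=; first by rewrite big1.
rewrite big_split /= -add1n leq_add //.
have [Lq|Lq] := ltnP (L x) q.
  rewrite (bigD1 (Ordinal Lq)) //= eqxx big1 // => v.
  by rewrite -val_eqE /= eq_sym => /negPf->.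
by rewrite big1 // => v _; case: eqP => // e; have := ltn_ord v; lia.
Qed.

Section Lists.
Variable w : nat.
Hypothesis w3 : 3 <= w.

(** Elements are prepended in decreasing order, so that every list comes out increasing, as [encode]
    demands. *)
Definition prog_link : cmd :=
  (fill aH rq 0 ;; rz <~ #rn ;;
   While ($0 < #rz)
     (rz <~ #rz - $1 ;;
      Store (idx aC #rz) (get aH (get aL #rz)) ;;
      Store (idx aH (get aL #rz)) (#rz + $1)))%prog.

Lemma prog_linkP s n q b :
  regs s rn = n -> regs s rq = q -> n * 8 + 8 <= 2 ^ w -> q * 8 + 8 <= 2 ^ w ->
  (forall z, z < n -> arr s aL z < q) -> q * 20 + n * 50 + 50 <= b ->
  runs w prog_link s b (fun s' => forall v, v < q ->
    chain (fun x => arr s' aC x) (arr s' aH v)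
      [seq x <- iota 0 n | arr s aL x == v]).
Proof.
move=> en eq nw qw HL Hb.
apply: (runs_seq (b1 := q * 20 + 20) (b2 := n * 50 + 30)); last by lia.
apply: runs_weaken w3 _ _ _ _ _ _ (fillP w3 _ _ _ eq _ (leqnn _))
  (leqnn _) _ => //; [lia|].
move=> s1 [fR1 fA1 _] H1.
apply: seq_assign => //=; first by lia.
have en1 : regs s1 rn = n by rewrite fR1.
apply: (@runs_loop_const w w3 (fun i s' => regs s' rz = n - i /\
  forall v, v < q ->
    chain (fun x => arr s' aC x) (arr s' aH v)
      [seq x <- iota (n - i) i | arr s aL x == v]) n 40) => //=.
- by rewrite /upd /= en1 subn0; split.
- by move=> i s' ik _ [iz _]; rewrite iz; split; lia.
- move=> i s' ik [fR fA fT] [iz H].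
  have [x nx] : exists x, n - i = x.+1 by exists (n - i).-1; lia.
  have nx' : n - i.+1 = x by lia.
  have xn : x < n by lia.
  have eL j : arr s' aL j = arr s aL j by rewrite fA // fA1.
  have Lx := HL x xn.
  rewrite nx' nx in iz H *.
  apply: seq_assign => //=; rewrite iz subn1 /=; first by lia.
  apply: seq_store => //=; rewrite !upd_same ?eL; [lia|lia|].
  apply: runs_store => //=; rewrite !upd_same ?upd_arr //= ?eL; [lia|lia|].
  split=> // v vq; rewrite upd_arr //=.
  (* The existing lists hold only elements above [x], so the new link stored at [x] leaves them
     intact. *)
  have tailE z : z \in [seq y <- iota x.+1 i | arr s aL y == v] -> x != z.
    by rewrite mem_filter mem_iota => /andP[_ /andP[h _]]; lia.
  have ch := H v vq.
  have ch' : chain (fun z => upd (upd (memory s') (x * 8 + 5) (arr s' aH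
    (arr s aL x)))
      (arr s aL x * 8 + 4) (x + 1) (z * 8 + 5)) (arr s' aH v)
      [seq y <- iota x.+1 i | arr s aL y == v].
    by apply: eq_chain ch => z /tailE/negPf zx; rewrite !upd_arr //= zx.
  case: eqP => [e|_]; last by rewrite upd_arr.
  rewrite /= addn1; split=> //.
  by move: ch'; rewrite -e upd_arr //= upd_same addn1.
- by rewrite /cost; lia.
- by move=> s' _ [_]; rewrite subnn.
Qed.

(** A shifted link is already the number of its element counted from 1, so it is output as it is; a
    null link ends the loop. *)
Definition prog_walk : cmd :=
  (While #ry (Output #ry ;; ry <~ get aC (#ry - $1)))%prog.

Lemma prog_walkP s n l b :
  n * 8 + 8 <= 2 ^ w -> all (fun x => x < n) l ->
  chain (fun x => arr s aC x) (regs s ry) l -> size l * 30 + 10 <= b ->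
  runs w prog_walk s b (fun s' => tape s' = tape s ++ [seq x.+1 | x <- l]).
Proof.
move=> nw; elim: l s b => [|x l IH] s b /=.
  move=> _ e Hb; apply: runs_while0 => //=; first by lia.
  by rewrite cats0.
move=> /andP[xn ln] [e c] Hb.
apply: (runs_whileS (b1 := 20) (b2 := size l * 30 + 10)) => //=;
  first by rewrite e.
  by lia.
apply: seq_output => //=; apply: runs_assign => //=; rewrite e subn1 /=;
  first by lia.
apply: runs_weaken (IH _ (size l * 30 + 10) _ _ _) _ _ => //=.
by move=> s' _ ->; rewrite cat_rcons.
Qed.

Definition prog_sets : cmd :=
  (rv <~ $0 ;;
   While (#rv < #rq)
     (ry <~ get aH #rv ;; prog_walk ;; Output $0 ;; incr rv))%prog.

Lemma prog_setsP s n q L b :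
  regs s rq = q -> n * 8 + 8 <= 2 ^ w -> q * 8 + 8 <= 2 ^ w ->
  (forall v, v < q -> chain (fun x => arr s aC x) (arr s aH v)
      [seq x <- iota 0 n | L x == v]) ->
  q * 50 + n * 30 + 20 <= b ->
  runs w prog_sets s b (fun s' => tape s' = tape s ++ column n q L).
Proof.
move=> eq nw qw HC Hb; apply: seq_assign => //=; [lia|lia|].
(* The walks are amortized: all [q] lists together have at most [n] elements. *)
pose c v := count (fun x => L x == v) (iota 0 n).
have Hc : \sum_(v < q) c v <= n by rewrite -[n in _ <=
  n](size_iota 0) sum_count_le.
apply: (@runs_loop w w3 (fun i s' => regs s' rv = i /\
  tape s' = tape s ++ column n i L) q (fun i => c i * 30 + 40)) => //=.
- by rewrite cats0.
- move=> i s' ik [fR fA fT] [iv _].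
  by rewrite iv fR //= /upd /= eq; split; lia.
- move=> i s' ik [fR fA fT] [iv H].
  have eC j : arr s' aC j = arr s aC j by rewrite fA.
  have eH j : arr s' aH j = arr s aH j by rewrite fA.
  apply: seq_assign => //=; rewrite ?iv ?eH; [lia|lia|].
  apply: (runs_seq (b1 := c i * 30 + 10) (b2 := 20)); last by lia.
  apply: runs_weaken (prog_walkP (n := n) (l :=
    [seq x <- iota 0 n | L x == i]) _ _ _ _) (leqnn _) _ => //=.
  + by apply/allP => x; rewrite mem_filter mem_iota => /andP[_ /andP[]].
  + by rewrite {1}/upd /=; apply: eq_chain (HC i ik) => x _.
  + by rewrite size_filter.
  move=> s1 [gR _ _] H1; have v1 : regs s1 rv = i by rewrite gR //= /upd /=.
  apply: seq_output => //=; first by lia.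
  apply: runs_assign => //=; rewrite v1; first by lia.
  rewrite /upd /= addn1; split=> //;
    rewrite H1 /= H /column -addn1 iotaD map_cat.
  by rewrite flatten_cat /= cats0 rcons_cat catA.
- have -> : \sum_(i < q) (c i * 30 + 40 + 4) = (\sum_(v < q) c v) * 30 + q * 44.
    rewrite big_distrl -[q in q * 44]card_ord -sum_nat_const -big_split /=.
    by apply: eq_bigr => i _; rewrite -addnA.
  by lia.
- by move=> s' _ [].
Qed.

(** Index z stands for the pair (z / q, z % q). Its entry comes from that of the halved pair by
    [xor_half], and the halved pair has a smaller index unless z = 0. *)
Definition prog_xor : cmd :=
  (rz <~ $0 ;;
   While (#rz < #rq * #rq)
     (Store (idx aX #rz)
        (get aX (#rz / #rq / $2 * #rq + #rz % #rq / $2) * $2 +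
         (#rz / #rq % $2 + #rz % #rq % $2) % $2) ;;
      incr rz))%prog.

Lemma prog_xorP s k q b :
  q = 2 ^ k -> regs s rq = q -> q * q * 8 + 8 <= 2 ^ w -> arr s aX 0 = 0 ->
  q * q * 70 + 20 <= b ->
  runs w prog_xor s b (fun s' => forall u v, u < q -> v < q ->
    arr s' aX (u * q + v) = xor u v).
Proof.
move=> qk eq qw X0 Hb; have q0 : 0 < q by rewrite qk expn_gt0.
have qq : q <= q * q by nia.
apply: seq_assign => //=; [lia|lia|].
apply: (@runs_loop_const w w3 (fun i s' => [/\ regs s' rz = i, arr s' aX 0 = 0 &
  forall j, j < i -> arr s' aX j = xor (j %/ q) (j %% q)]) (q * q) 50) => //=.
- move=> i s' ik [fR fA fT] [iz _ _].
  by rewrite iz fR //= /upd /= eq; split; lia.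
- move=> i s' ik [fR fA fT] [iz Z H].
  have eq' : regs s' rq = q by rewrite fR.
  set u := i %/ q; set v := i %% q.
  have uq : u < q by rewrite /u ltn_divLR.
  have vq : v < q by rewrite /v ltn_mod.
  have iE : i = u * q + v by rewrite /u /v -divn_eq.
  have hu : u %/ 2 <= u by lia.
  have E : arr s' aX (u %/ 2 * q + v %/ 2) = xor (u %/ 2) (v %/ 2).
    (* Entry 0 refers to itself and relies on the memory being 0 there. *)
    have [i0|i0] := posnP i.
      by move: Z; rewrite /u /v i0 div0n mod0n !div0n.
    have vh : v %/ 2 <= v by lia.
    have lt : u %/ 2 * q + v %/ 2 < i.
      have [u0|u0] := posnP u; first by rewrite u0 in iE *; lia.
      have : (u %/ 2).+1 * q <= u * q by rewrite leq_mul2r; apply/orP; right;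
        lia.
      by rewrite mulSn; lia.
    have vhq : v %/ 2 < q by lia.
    by rewrite H // divnMDl // (divn_small vhq) addn0 modnMDl (modn_small vhq).
  have xq : xor u v < q by rewrite qk; apply: xor_lt; rewrite -qk.
  have xh := xor_half u v; rewrite mulnC in xh.
  have ad : u %/ 2 * q + v %/ 2 < q * q by nia.
  have ad2 : u %/ 2 * q <= q * q by nia.
  apply: seq_store => //=; rewrite ?iz ?eq' -/u -/v ?E; [lia|lia|].
  apply: runs_assign => //=; rewrite iz; first by lia.
  rewrite {1}/upd /= addn1; split=> //.
    rewrite upd_arr //= eqtype.eq_sym; case: eqP => // i0.
    by rewrite -xh /u /v -i0 div0n mod0n.
  move=> j ji; rewrite upd_arr //= eqtype.eq_sym; case: eqP => [->|ne];
    first by rewrite -xh.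
  by apply: H; lia.
- by rewrite /cost; lia.
- move=> s' _ [_ _ H] u v uq vq; rewrite H; last by nia.
  by rewrite divnMDl // divn_small // addn0 modnMDl modn_small.
Qed.

End Lists.

(** * The complete program *)

Lemma encode_cat n (l1 l2 : seq {set 'I_n}) : encode (l1 ++ l2) =
  encode l1 ++ encode l2.
Proof. by rewrite /encode map_cat flatten_cat. Qed.

Lemma encode_fibers n q Ls : encode (fibers n q Ls) =
  flatten [seq column n q L | L <- Ls].
Proof.
elim: Ls => //= L Ls IH; rewrite /fibers /= encode_cat -IH; congr (_ ++ _).
rewrite /encode -map_comp; congr flatten; apply: eq_map => v /=; congr rcons.
rewrite -val_enum_ord filter_map -map_comp /=.
have -> : enum (fiber n L v) = [seq i <- enum 'I_n | L (val i) == v].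
  by rewrite enumT; apply: eq_filter => i; rewrite /= /fiber inE.
by [].
Qed.

Lemma size_fibers n q Ls : size (fibers n q Ls) = size Ls * q.
Proof.
elim: Ls => //= L Ls IH; rewrite /fibers /= size_cat size_map size_iota.
by rewrite mulSn -IH.
Qed.

Definition singletons (n S : nat) : seq {set 'I_n} :=
  [seq [set x] | x <- take S (enum 'I_n)].

Lemma size_singletons n S : S <= n -> size (singletons n S) = S.
Proof. by move=> Sn; rewrite size_map size_takel // size_enum_ord. Qed.

Lemma uniq_singletons n S : uniq (singletons n S).
Proof. by rewrite map_inj_uniq ?take_uniq ?enum_uniq //; exact: set1_inj. Qed.

Lemma encode_singletons n S :
  S <= n -> encode (singletons n S) = flatten [seq [:: x.+1;
    0] | x <- iota 0 S].
Proof.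
move=> Sn; rewrite /encode -map_comp.
have -> : iota 0 S = [seq val x | x <- take S (enum 'I_n)].
  by rewrite map_take val_enum_ord take_iota (minn_idPl Sn).
rewrite -map_comp; congr flatten; apply: eq_map => x /=.
by rewrite enum_set1.
Qed.

Lemma singletons_strongly_selective n r (F : {set {set 'I_n}}) :
  {subset singletons n n <= F} -> strongly_selective n r F.
Proof.
move=> sF A _ x xA; exists [set x].
  apply: sF; apply: map_f; rewrite take_oversize ?mem_enum //.
  by rewrite size_enum_ord.
by apply/setP => y; rewrite !inE; case: eqP => [->|]; rewrite ?xA ?andbF.
Qed.

Section Main.
Variable w : nat.
Hypothesis w3 : 3 <= w.

Definition prog_columns : cmd :=
  (rj <~ $0 ;;
   While (#rj < $2 * #rr * #rK) (prog_column ;; prog_link ;; prog_sets ;;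
     incr rj))%prog.

(** The list [Ls] of maps chosen so far is a ghost variable of the invariant: the stored weights are
    its terms [2 ^ zeros Ls z], and its potential obeys the bound (1 + 1/q)^j 2^K. *)
Lemma prog_columnsP s n r K k q b :
  regs s rn = n -> regs s rr = r -> regs s rK = K -> regs s rN = 2 ^ K ->
  regs s rq = q -> q = 2 ^ k -> 0 < r -> 4 * r <= q -> n < 2 ^ K ->
  2 ^ K * 2 ^ K * 8 + 8 <= 2 ^ w -> q * q * 8 + 8 <= 2 ^ w ->
  2 * r * K + 1 < 2 ^ w ->
  arr s aL 0 = 0 ->
  (forall u v, u < q -> v < q -> arr s aX (u * q + v) = xor u v) ->
  (forall z, z < 2 ^ K -> arr s aW z = 1) ->
  2 * r * K * (K *
    (q * 70 + 210) + 2 ^ K * 150 + q * 70 + n * 80 + 130) + 20 <= b ->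
  runs w prog_columns s b (fun s' => exists Ls, [/\ size Ls = 2 * r * K,
     tape s' = tape s ++ encode (fibers n q Ls) &
     forall F : {set {set 'I_n}}, {subset fibers n q Ls <= F} ->
       strongly_selective n r F]).
Proof.
move=> en er eK eN eq qk r0 qr nK Kw qw mw L0 HX HW Hb.
have q0 : 0 < q by lia.
have qq : q <= q * q by nia.
have N1 : 0 < 2 ^ K by rewrite expn_gt0.
have NN : 2 ^ K <= 2 ^ K * 2 ^ K by nia.
have rK2 : 2 * r <= q * q by nia.
apply: seq_assign => //=; [lia|lia|].
apply: (@runs_loop_const w w3 (fun j s' => [/\ regs s' rj = j, arr s' aL 0 = 0 &
   exists Ls : seq (nat -> nat), [/\ size Ls = j,
     forall i, i < size Ls -> xor_linear K (nth id Ls i) /\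
       forall z, z < 2 ^ K -> nth id Ls i z < q,
     forall z, 0 < z < 2 ^ K -> arr s' aW z = 2 ^ zeros Ls z,
     q ^ size Ls * potential Ls (2 ^ K) <= q.+1 ^ size Ls * 2 ^ K &
     tape s' = tape s ++ encode (fibers n q Ls)]]) (2 * r * K)
  (K * (q * 70 + 210) + 2 ^ K * 150 + q * 70 + n * 80 + 120)) => //=.
- split=> //; exists [::]; split=> //=; last by rewrite cats0.
    by move=> z /andP[_ zK]; rewrite HW // /zeros big_nil.
  rewrite !expn0 !mul1n /potential.
  under eq_bigr do rewrite /zeros big_nil expn0.
  by rewrite sum_nat_const_nat muln1 leq_subr.
- move=> j s' jm [fR _ _] [e _ _].
  by rewrite e !fR //= /upd /= er eK; split; lia.
- move=> j s' jm [fR fA _] [ej L0' [Ls [sz good HWz pot tp]]].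
  have en' : regs s' rn = n by rewrite fR.
  have eN' : regs s' rN = 2 ^ K by rewrite fR.
  have eq' : regs s' rq = q by rewrite fR.
  (* As 32/9 < 4, the potential stays within 4^K, and no weight computation overflows. *)
  have Hpot : potential Ls (2 ^ K) <= 2 ^ K * 2 ^ K.
    have := potential_le r0 qr (_ : size Ls <= 2 * r * K) pot.
    rewrite sz => /(_ (ltnW jm)) H;
      rewrite -(leq_pmul2l (_ : 0 < 9 ^ K)) ?expn_gt0 //.
    apply: leq_trans H _; rewrite -!expnMn.
    by case: (K) => // K'; rewrite leq_exp2r.
  have sumW : \sum_(1 <= z < 2 ^ K) arr s' aW z = potential Ls (2 ^ K).
    by apply: eq_big_nat => z zK; apply: HWz.
  apply: (runs_seq (b1 := K * (q * 70 + 210) + 2 ^ K * 150 + 20)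
    (b2 := q * 70 + n * 80 + 100)); last by lia.
  apply: runs_weaken w3 _ _ _ _ _ _
    (prog_columnP w3 eN' eq' q0 _ qw L0' _ _ _ (leqnn _)) (leqnn _) _.
  + by lia.
  + by move=> u v uq vq; rewrite qk xor_lt // -qk.
  + by move=> u v uq vq; rewrite fA // HX.
  + by rewrite sumW; lia.
  move=> s1 [gR1 _ gT1] [lin Lq W1 pot1].
  have en1 : regs s1 rn = n by rewrite gR1.
  have eq1 : regs s1 rq = q by rewrite gR1.
  have ej1 : regs s1 rj = j by rewrite gR1.
  apply: (runs_seq (b1 := q * 20 + n * 50 + 50) (b2 := q * 50 + n * 30 + 50));
    last by lia.
  apply: runs_weaken w3 _ _ _ _ _ _
    (prog_linkP w3 en1 eq1 _ _ _ (leqnn _)) (leqnn _) _; [lia|lia| |].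
    by move=> z zn; apply: Lq; lia.
  move=> s2 [gR2 gA2 gT2] H2.
  have eq2 : regs s2 rq = q by rewrite gR2.
  have ej2 : regs s2 rj = j by rewrite gR2.
  apply: (runs_seq (b1 := q * 50 + n * 30 + 20) (b2 := 30)); last by lia.
  apply: runs_weaken w3 _ _ _ _ _ _
    (prog_setsP w3 eq2 _ _ H2 (leqnn _)) (leqnn _) _; [lia|lia|].
  move=> s3 [gR3 gA3 _] H3.
  have ej3 : regs s3 rj = j by rewrite gR3.
  have eL3 z : arr s3 aL z = arr s1 aL z by rewrite gA3 // gA2.
  have eW3 z : arr s3 aW z = arr s1 aW z by rewrite gA3 // gA2.
  apply: runs_assign => //=; first by rewrite ej3; lia.
  split; [by rewrite /upd /= ej3 addn1 | by rewrite eL3; case: lin |].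
  pose L z := arr s1 aL z.
  exists (rcons Ls L); split.
  + by rewrite size_rcons sz.
  + move=> i; rewrite size_rcons ltnS nth_rcons => ile.
    move: ile; rewrite leq_eqVlt => /orP[/eqP->|il]; first by rewrite ltnn eqxx.
    by rewrite il; apply: good.
  + move=> z zK; rewrite eW3 W1 // HWz // zeros_rcons /L.
    by case: eqP => _; rewrite ?addn0 // addn1 expnS mulnC.
  + rewrite size_rcons !expnSr -!mulnA.
    have P1 := potential_rcons (q := q) (N := 2 ^ K) (Ls := Ls) (L := L) _.
    have {}P1 : q * potential (rcons Ls L) (2 ^ K) <= q.+1 * potential Ls
      (2 ^ K).
      apply: P1; rewrite -sumW; apply: leq_trans pot1.
      rewrite leq_pmul2l // [X in X <= _]big_nat_cond [X in _ <= X]big_nat_cond.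
      by apply: leq_sum => z /andP[zK _]; rewrite HWz.
    apply: leq_trans (leq_mul (leqnn _) P1) _.
    by rewrite mulnCA [X in _ <= X]mulnCA leq_pmul2l.
  + rewrite H3 gT2 // gT1 // tp -catA !encode_fibers map_rcons.
    by rewrite -cats1 flatten_cat /= cats0.
- rewrite /cost; lia.
move=> s' _ [_ _ [Ls [sz good HWz pot tp]]]; exists Ls; split=> // F.
apply: (fibers_strongly_selective r0 nK sz good) => z zK.
apply: (zeros_lt _ zK); apply: (potential_le r0 qr _ pot).
by rewrite sz.
Qed.

End Main.

Definition bits (n : nat) : nat := (trunc_log 2 n).+1.

Section Main.
Variable w : nat.
Hypothesis w3 : 3 <= w.

Definition prog_bits : cmd :=
  (rN <~ $1 ;; While (#rN < #rn + $1) (rN <~ #rN * $2 ;; incr rK))%prog.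

Lemma prog_bitsP s n b :
  0 < n -> regs s rn = n -> regs s rK = 0 -> n * 8 + 8 <= 2 ^ w ->
  bits n * 20 + 20 <= b ->
  runs w prog_bits s b (fun s' => regs s' rK = bits n /\
    regs s' rN = 2 ^ bits n).
Proof.
move=> n0 en eK nw Hb; have /andP[lo hi] := trunc_log_bounds (isT : 1 < 2) n0.
have bn : bits n <= n by rewrite /bits; apply: leq_trans lo; exact: ltn_expl.
apply: seq_assign => //=; [lia|lia|].
apply: (@runs_loop_const w w3 (fun i s' => regs s' rK = i /\ regs s' rN = 2 ^ i)
  (bits n) 12) => //=.
- move=> i s' ik [fR _ _] [iK iN].
  have en' : regs s' rn = n by rewrite fR.
  have le : (2 ^ i <= n) = (i < bits n).
    have [ib|ib] := ltnP i (bits n).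
      by apply: leq_trans lo; rewrite leq_exp2l.
    by apply/negbTE; rewrite -ltnNge (leq_trans hi) // leq_exp2l.
  by rewrite iN en' addn1 ltnS le; split; lia.
- move=> i s' ik _ [iK iN].
  have le : 2 ^ i <= n by apply: leq_trans lo; rewrite leq_exp2l.
  apply: seq_assign => //=; first by rewrite iN; lia.
  apply: runs_assign => //=; rewrite /upd /= iK; first by lia.
  by rewrite iN addn1 expnS mulnC.
- by rewrite /cost; lia.
Qed.

Definition prog_singletons : cmd :=
  (rG <~ #rr * #rr * #rK ;;
   If (#rG < #rn) (rS <~ #rG) (rS <~ #rn) ;;
   rz <~ $0 ;;
   While (#rz < #rS) (incr rz ;; Output #rz ;; Output $0))%prog.

Lemma prog_singletonsP s n r K b :
  regs s rn = n -> regs s rr = r -> regs s rK = K -> 0 < K ->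
  n * 8 + 8 <= 2 ^ w -> r * r * K < 2 ^ w ->
  minn n (r * r * K) * 20 + 40 <= b ->
  runs w prog_singletons s b (fun s' => regs s' rG = r * r * K /\
    tape s' = tape s ++
      flatten [seq [:: x.+1; 0] | x <- iota 0 (minn n (r * r * K))]).
Proof.
move=> en er eK K0 nw Gw Hb; set G := r * r * K in Gw Hb *.
have rG2 : r * r <= G by rewrite /G leq_pmulr.
apply: seq_assign => //=; rewrite ?er ?eK; [lia|lia|].
apply: (runs_seq (b1 := 10) (b2 := b - 16)); last by lia.
pose Q s1 := [/\ regs s1 rG = G, regs s1 rS = minn n G & tape s1 = tape s].
suff H s1 : Q s1 -> runs w (rz <~ $0 ;;
   While (#rz < #rS) (incr rz ;; Output #rz ;; Output $0))%prog s1 (b - 16)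
   (fun s' => regs s' rG = G /\
    tape s' = tape s ++ flatten [seq [:: x.+1; 0] | x <- iota 0 (minn n G)]).
  apply: (runs_if (b1 := 3)) => //=; rewrite /upd /= en -/G; first by lia.
    move=> lt; apply: runs_assign => //; apply: H; rewrite /Q /=; split=> //.
    by rewrite /upd /=; symmetry; apply/minn_idPr; lia.
  move=> lt; apply: runs_assign => //; apply: H; rewrite /Q /=; split=> //.
  by rewrite /upd /= en; symmetry; apply/minn_idPl; lia.
move=> [eG eS eT]; apply: seq_assign => //=; [lia|lia|].
apply: (@runs_loop_const w w3 (fun i s' => regs s' rz = i /\ tape s' = tape s ++
  flatten [seq [:: x.+1; 0] | x <- iota 0 i]) (minn n G) 14) => //=.
- by rewrite cats0.
- move=> i s' ik [fR _ _] [iz _].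
  by rewrite iz fR //= /upd /= eS; split; lia.
- move=> i s' ik _ [iz T].
  apply: seq_assign => //=; first by rewrite iz; lia.
  apply: seq_output => //=; apply: runs_output => //=; first by lia.
  rewrite /upd /= iz addn1; split=> //.
  have : flatten [seq [:: x.+1; 0] | x <- iota 0 i.+1] =
      flatten [seq [:: x.+1; 0] | x <- iota 0 i] ++ [:: i.+1; 0].
    by rewrite -{1}addn1 iotaD map_cat flatten_cat.
  by rewrite /= T -!cats1 -!catA => ->.
- by rewrite /cost; lia.
- by move=> s' [fR _ _] [_ T]; rewrite fR.
Qed.

Definition prog_pow2 : cmd :=
  (rq <~ $4 ;; While (#rq < $4 * #rr) (rq <~ #rq * $2))%prog.

Lemma prog_pow2P s r b :
  0 < r -> regs s rr = r -> r * 8 + 8 <= 2 ^ w -> r * 20 + 20 <= b ->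
  runs w prog_pow2 s b (fun s' => exists k, [/\ regs s' rq =
    2 ^ k, 4 * r <= 2 ^ k
    & 2 ^ k <= 8 * r]).
Proof.
move=> r0 er rw Hb.
(* The number of doublings is the rounded-up binary logarithm of [r]; r = 1 is settled apart because
   [up_log_bounds] starts at 2. *)
have [k [kr lo hi]] : exists k, [/\ k <= r, r <= 2 ^ k &
    forall i, i < k -> 2 ^ i < r].
  exists (up_log 2 r); have [r1|r1] := leqP r 1.
    by have -> : r = 1 by lia.
  have /andP[lo hi] := up_log_bounds (isT : 1 < 2) r1.
  split=> //; last first.
    by move=> i ik; apply: leq_ltn_trans lo; rewrite leq_exp2l //; lia.
  by apply: up_log_min => //; rewrite ltnW // ltn_expl.
apply: seq_assign => //=; [lia|lia|].
apply: (@runs_loop_const w w3 (fun i s' => regs s' rq = 4 * 2 ^ i) k 10) => //=.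
- move=> i s' ik [fR _ _] iq; rewrite fR //= /upd /= iq er.
  have le : (4 * 2 ^ i < 4 * r) = (i < k).
    rewrite ltn_pmul2l //; have [ib|ib] := ltnP i k; first exact: hi.
    by apply/negbTE; rewrite -leqNgt (leq_trans lo) // leq_exp2l.
  by rewrite le; split; lia.
- move=> i s' ik _ iq; have := hi i ik => lt.
  apply: runs_assign => //=; first by rewrite iq; lia.
  by rewrite /upd /= iq expnS; lia.
- by rewrite /cost; lia.
(* The register started at 4, hence the shift by two; 2^(k - 1) < r gives the upper bound 8r. *)
move=> s' _ e; exists k.+2; rewrite e !expnS; split; [lia|lia|].
case: k kr lo hi e => [|k] kr lo hi e; first by lia.
by have := hi k (leqnn _); rewrite expnS; lia.
Qed.

Definition prog_code : cmd :=
  (prog_pow2 ;; prog_xor ;; fill aW rN 1 ;; prog_columns)%prog.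

(* Literals above 5000 are opaque to lia, hence constants such as 90 * 100. *)
Lemma prog_codeP s n r K b :
  regs s rn = n -> regs s rr = r -> regs s rK = K -> regs s rN = 2 ^ K ->
  0 < n -> 0 < r -> 0 < K -> n < 2 ^ K -> 2 ^ K <= n * 2 -> r * r * K < n ->
  n * n * 600 <= 2 ^ w ->
  (forall t i, t < 8 -> arr s t i = 0) ->
  r * n * K * (90 * 100) <= b ->
  runs w prog_code s b (fun s' => exists q Ls, [/\ size Ls =
    2 * r * K, q <= 8 * r,
     tape s' = tape s ++ encode (fibers n q Ls) &
     forall F : {set {set 'I_n}}, {subset fibers n q Ls <= F} ->
       strongly_selective n r F]).
Proof.
move=> en er eK eN n0 r0 K0 nK Kn Gn nw Z Hb.
have rn' : r * r < n by nia.
have rK' : r * K < n by nia.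
have r1n : r < n by nia.
have KN : K < n by nia.
have nn : n <= n * n by nia.
have rKn : n <= r * n * K by nia.
apply: (runs_seq (b1 := r * 20 + 20) (b2 := r * n * K * (89 * 100)));
  last by lia.
apply: runs_weaken w3 _ _ _ _ _ _ (prog_pow2P r0 er _ (leqnn _)) (leqnn _) _;
  first by lia.
move=> s1 [fR1 fA1 fT1] [k [eq1 qlo qhi]]; set q := 2 ^ k in eq1 qlo qhi.
(* From q <= 8r and r^2 < n: the xor table has O(n) entries. *)
have qq : q * q <= n * 64 by nia.
have qn : q <= n * 8 by lia.
apply: (runs_seq (b1 := q * q * 70 + 20) (b2 := r * n * K * 4100)); last by lia.
apply: runs_weaken w3 _ _ _ _ _ _
  (prog_xorP w3 (k := k) erefl eq1 _ _ (leqnn _)) (leqnn _) _.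
- by rewrite -/q; lia.
- by rewrite fA1 // Z.
move=> s2 [fR2 fA2 fT2] X2.
have eN2 : regs s2 rN = 2 ^ K by rewrite fR2 // fR1.
apply: (runs_seq (b1 := 2 ^ K * 20 + 20) (b2 := r * n * K * 4000)); last by lia.
apply: runs_weaken w3 _ _ _ _ _ _ (fillP w3 _ _ _ eN2 _ (leqnn _))
  (leqnn _) _ => //.
- by lia.
- by lia.
move=> s3 [fR3 fA3 fT3] W3.
have time : 2 * r * K * (K *
  (q * 70 + 210) + 2 ^ K * 150 + q * 70 + n * 80 + 130) + 20
    <= r * n * K * 4000.
  (* Since rK < n, clearing and scanning q buckets for each of the K bits still costs O(n) per
     map. *)
  have Kq : K * q <= n * 8 by nia.
  have T1 : K *
    (q * 70 + 210) + 2 ^ K * 150 + q * 70 + n * 80 + 130 <= n * 1840 by lia.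
  apply: leq_trans (leq_add (leq_mul (leqnn (2 * r * K)) T1) (leqnn 20)) _.
  clear - rKn n0; lia.
apply: runs_weaken w3 _ _ _ _ _ _
  (prog_columnsP w3 (n := n) (r := r) (K := K) (k := k) (q :=
    q) _ _ _ _ _ erefl r0 qlo nK
    _ _ _ _ _ W3 time) (leqnn _) _.
- by rewrite fR3 // fR2 // fR1.
- by rewrite fR3 // fR2 // fR1.
- by rewrite fR3 // fR2 // fR1.
- by rewrite fR3.
- by rewrite fR3 // fR2.
- by have := leq_mul Kn Kn; lia.
- by lia.
- by lia.
- by rewrite fA3 // fA2 // fA1 // Z.
- by move=> u v uq vq; rewrite fA3 // X2.
move=> s4 _ [Ls [sz tp ss]]; exists q, Ls; split=> //.
by rewrite tp fT3 // fT2 // fT1.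
Qed.

Definition prog_pad : cmd :=
  (rz <~ $0 ;; While (#rz < #rr * #rn * #rK) (incr rz))%prog.

(** Stated with [exec] instead of [runs], because the number of steps is bounded from below as
    well. *)
Lemma prog_padP s n r K :
  regs s rn = n -> regs s rr = r -> regs s rK = K -> r * n * K < 2 ^ w ->
    r * n < 2 ^ w ->
  exists t s', [/\ exec w prog_pad s t s', r * n * K <= t <=
    r * n * K * 20 + 20 &
    tape s' = tape s].
Proof.
move=> en er eK mw mw'; set m := r * n * K in mw *.
have H d s1 : regs s1 rn = n -> regs s1 rr = r -> regs s1 rK = K ->
    regs s1 rz + d = m ->
    exists t s', [/\ exec w (While (#rz < #rr * #rn * #rK)%prog
      (incr rz)) s1 t s',
      d <= t <= d * 20 + 10 & tape s' = tape s1].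
  elim: d s1 => [|d IH] s1 hn hr hK hz.
    exists 8, s1; split=> //; constructor; rewrite evalE /= ?hn ?hr ?hK -/m;
      lia.
  pose s2 := State (upd (regs s1) rz (regs s1 rz).+1) (memory s1) (tape s1).
  have hz2 : regs s2 rz + d = m by rewrite /s2 /= /upd /=; lia.
  have [t [s' [E ht T]]] := IH s2 hn hr hK hz2.
  exists (8 + 4 + t), s'; split=> //; last by lia.
  apply: EWhileTrue E; first by rewrite evalE /= ?hn ?hr ?hK -/m; lia.
  have -> : s2 =
    State (upd (regs s1) rz (eval w s1 (#rz + $1)%prog)) (memory s1) (tape s1).
    by rewrite evalE /= ?addn1 //; lia.
  by constructor.
have [t [s' [E ht T]]] :=
  H m (State (upd (regs s) rz 0) (memory s) (tape s)) en er eK (add0n m).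
exists (2 + t), s'; split=> //; last by lia.
by apply: ESeq E; have := EAssign w rz (Lit 0) s; rewrite /= mod0n.
Qed.

Definition prog_main : cmd :=
  (prog_bits ;; prog_singletons ;; If (#rG < #rn) prog_code Skip ;;
    prog_pad)%prog.

(** The cube of V dominates rnK, r^2 K and n^2, so the single hypothesis on V rules out overflow in
    every part of the program. *)
Lemma prog_mainP n r :
  0 < n -> 0 < r -> let V := n + r in V * V * V * 600 <= 2 ^ w ->
  let K := bits n in let G := r * r * K in
  exists t s' l, [/\ exec w prog_main (init n r) t s', tape s' = encode l,
    r * n * K <= t <= r * n * K * (100 * 100),
    strongly_selective n r [set B in l] &
    minn n G <= #|[set B in l]| /\ size l <= 17 * minn n G].
Proof.
move=> n0 r0 V Vw K G.
have /andP[lo hi] := trunc_log_bounds (isT : 1 < 2) n0.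
have Kn : K <= n by rewrite /K /bits; apply: leq_trans lo; exact: ltn_expl.
have K2 : 2 ^ K <= n * 2 by rewrite expnS mulnC leq_pmul2r.
have K0 : 0 < K by [].
have rnK : r * n * K <= V * V * V by rewrite !leq_mul // /V; lia.
have rrK : r * r * K <= V * V * V by rewrite !leq_mul // /V; lia.
have VV : V * V <= V * V * V by rewrite leq_pmulr // /V; lia.
have VV' : V <= V * V by rewrite leq_pmulr // /V; lia.
have nnV : n * n <= V * V by rewrite !leq_mul // /V; lia.
have rnV : r * n <= V * V by rewrite !leq_mul // /V; lia.
have nV : n <= V by rewrite /V; lia.
have rnK0 : n <= r * n * K by rewrite mulnAC leq_pmull // muln_gt0 r0.
have rnK1 : K <= r * n * K by rewrite leq_pmull // muln_gt0 r0.
pose s0 := init n r.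
have [t1 [s1 [E1 h1 [[fR1 fA1 fT1] [k1 N1]]]]] : runs w prog_bits s0
  (K * 20 + 20)
    (fun s' => frame prog_bits s0 s' /\ (regs s' rK = K /\ regs s' rN = 2 ^ K)).
  apply: runs_weaken w3 _ _ _ _ _ _ (prog_bitsP n0 _ _ _ (leqnn _))
    (leqnn _) _ => //.
  by lia.
have n1 : regs s1 rn = n by rewrite fR1.
have r1 : regs s1 rr = r by rewrite fR1.
have [t2 [s2 [E2 h2 [[fR2 fA2 _] [G2 T2]]]]] : runs w prog_singletons s1
  (minn n G * 20 + 40)
    (fun s' => frame prog_singletons s1 s' /\ (regs s' rG = G /\
    tape s' = tape s1 ++ flatten [seq [:: x.+1; 0] | x <- iota 0 (minn n G)])).
  apply: runs_weaken w3 _ _ _ _ _ _ (prog_singletonsP n1 r1 k1 K0 _ _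
    (leqnn _)) (leqnn _) _ => //.
    by lia.
  by lia.
have mG : minn n G <= n by rewrite geq_minl.
rewrite fT1 //= -(encode_singletons mG) in T2.
have n2 : regs s2 rn = n by rewrite fR2.
have r2 : regs s2 rr = r by rewrite fR2.
have k2 : regs s2 rK = K by rewrite fR2.
have N2 : regs s2 rN = 2 ^ K by rewrite fR2.
have [t3 [s3 [E3 h3 [[fR3 _ _] [l' [T3 SS sz]]]]]] :
   runs w (If (#rG < #rn) prog_code Skip)%prog s2 (r * n * K * (90 * 100 + 5))
    (fun s' => frame (If (#rG < #rn) prog_code Skip)%prog s2 s' /\
     exists l', [/\ tape s' = tape s2 ++ encode l',
       strongly_selective n r [set B in singletons n (minn n G) ++ l'] &
       size l' <= 16 * minn n G]).
  have R b Q : runs w (If (#rG < #rn) prog_code Skip)%prog s2 b Q ->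
      runs w (If (#rG < #rn) prog_code Skip)%prog s2 b
      (fun s' => frame (If (#rG < #rn) prog_code Skip)%prog s2 s' /\ Q s').
    by move=> RQ; apply: runs_weaken w3 _ _ _ _ _ _ RQ (leqnn _) _.
  apply: R; apply: (runs_if (b1 := r * n * K * (90 * 100))) => //=;
    rewrite ?G2 ?n2.
  + by lia.
  + by lia.
  + move=> lt; have {}lt : G < n by lia.
    apply: runs_weaken w3 _ _ _ _ _ _
      (prog_codeP n2 r2 k2 N2 n0 r0 K0 hi K2 lt _ _ (leqnn _)) (leqnn _) _.
    * by lia.
    * by move=> t i t8; rewrite fA2 // fA1.
    move=> s' _ [q [Ls [sz qr tp ss]]]; exists (fibers n q Ls); split=> //.
      by apply: ss => B; rewrite inE mem_cat => ->; rewrite orbT.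
    (* There are 2rK maps with q <= 8r fibers each, in total at most 16 r^2 K; the singletons later
       raise the factor to 17. *)
    rewrite size_fibers sz (minn_idPr (ltnW lt)) /G.
    have := leq_mul (leqnn (2 * r * K)) qr; lia.
  + move=> ge; have {}ge : n <= G by lia.
    apply: runs_skip; first by lia.
    exists [::]; split=> //; first by rewrite cats0.
    apply: singletons_strongly_selective => B.
    by rewrite inE (minn_idPl ge) cats0.
have n3 : regs s3 rn = n by rewrite fR3.
have r3 : regs s3 rr = r by rewrite fR3.
have k3 : regs s3 rK = K by rewrite fR3.
have [|| t4 [s4 [E4 h4 T4]]] := prog_padP n3 r3 k3; [lia|lia|].
exists (t1 + (t2 + (t3 + t4))), s4, (singletons n (minn n G) ++ l'); split.
- exact: ESeq E1 (ESeq E2 (ESeq E3 E4)).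
- by rewrite T4 T3 T2 encode_cat.
- by lia.
- exact: SS.
split; last by rewrite size_cat size_singletons //; lia.
(* Fibers may coincide or be empty; the singletons alone supply enough distinct sets. *)
rewrite -[X in X <= _](size_singletons mG) -(card_uniqP (uniq_singletons n _)).
by apply: subset_leq_card; apply/subsetP => B H; rewrite inE mem_cat H.
Qed.

End Main.

(** * Asymptotics *)

(** The factor 13 is 3 + 10: the cube of n + r takes three, and (n + r)^10 >= 2^10 covers the
    constant 600. *)
Lemma word_size_large n r : 0 < n -> 0 < r ->
  3 <= word_size 13 n r /\
  (n + r) * (n + r) * (n + r) * 600 <= 2 ^ word_size 13 n r.
Proof.
move=> n0 r0; split; first by rewrite /word_size; lia.
have V0 : 0 < n + r by lia.
have /andP[_ hi] := trunc_log_bounds (isT : 1 < 2) V0.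
rewrite /word_size [13 * _]mulnC expnM.
apply: (@leq_trans ((n + r) ^ 13)); last by rewrite leq_exp2r // ltnW.
rewrite -[13]/(3 + 10) expnD; apply: leq_mul;
  first by rewrite !expnS expn0 muln1 mulnA.
apply: (@leq_trans (2 ^ 10)); first by vm_compute.
by rewrite leq_exp2r //; lia.
Qed.

Local Open Scope ring_scope.

Lemma ln2_le1 (R : realType) : (ln 2 : R) <= 1.
Proof.
by have := @le_ln1Dx R 1; rewrite -[1 + 1]/(2%:R); apply;
  rewrite (lt_trans (ltrN10 _)).
Qed.

(** With t the integer part of the binary logarithm, t ln 2 <= ln n <= (t + 1) ln 2. As n >= 2, t >=
    1 and hence t >= (t + 1)/2; above, ln 2 <= 1. *)
Lemma ln_bits (R : realType) (n : nat) : (1 < n)%N ->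
  ln 2 / 2 * (bits n)%:R <= (ln n%:R : R) <= (bits n)%:R.
Proof.
move=> n1; have n0 : (0 < n)%N by lia.
have /andP[lo hi] := trunc_log_bounds (isT : (1 < 2)%N) n0.
have l0 : 0 < (ln 2 : R) by rewrite ln_gt0 // ltr1n.
have l1 := ln2_le1 R.
have nR : (n%:R : R) \is Num.pos by rewrite posrE ltr0n.
have pR k : (2 ^+ k : R) \is Num.pos by rewrite posrE exprn_gt0.
have lnX k : ln (2 ^+ k : R) = k%:R * ln 2.
  by rewrite lnXn ?ltr0n // mulr_natl.
apply/andP; split.
  apply: (@le_trans _ _ (ln (2 ^+ trunc_log 2 n))); last first.
    by rewrite ler_ln // -natrX ler_nat.
  rewrite lnX -mulrA mulrC ler_pM2r //.
  have t1 : (0 < trunc_log 2 n)%N by rewrite trunc_log_gt0 /=; lia.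
  rewrite mulrC ler_pdivrMr ?ltr0n // -natrM ler_nat /bits; lia.
apply: (@le_trans _ _ (ln (2 ^+ bits n))).
  by rewrite ler_ln // -natrX ler_nat ltnW.
by rewrite lnX -[leRHS]mulr1 ler_pM2l // ltr0n.
Qed.

(** The integer quantity [m], with bit lengths in place of logarithms, mediates between the program
    and the real bound. Taking [C.+1] keeps the upper constant positive even for C = 0. *)
Lemma Theta_bits (R : realType) (f m : nat -> nat -> nat) (g : nat -> nat -> R)
    (C : nat) (c : R) :
  0 < c ->
  (forall n r, (1 < n)%N -> (0 < r)%N -> (m n r <= f n r <= C * m n r)%N) ->
  (forall n r, (1 < n)%N -> (0 < r)%N ->
    c * (m n r)%:R <= g n r <= (m n r)%:R) ->
  Theta f g.
Proof.
move=> c0 Hf Hg; exists 1, (C.+1%:R / c); split=> //.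
  by rewrite divr_gt0 ?ltr0n.
move=> n r n1 r0; have /andP[f1 f2] := Hf n r n1 r0.
have /andP[g1 g2] := Hg n r n1 r0; rewrite mul1r; apply/andP; split.
  by apply: le_trans g2 _; rewrite ler_nat.
rewrite -mulrA; apply: (@le_trans _ _ (C.+1%:R * (m n r)%:R)).
  by rewrite -natrM ler_nat mulSn (leq_trans f2) // leq_addl.
by rewrite ler_pM2l ?ltr0n // ler_pdivlMl.
Qed.

Theorem theorem1 (R : realType) :
  exists (p : cmd) (c : nat) (F : forall n : nat, nat -> seq {set 'I_n})
         (T : nat -> nat -> nat),
    [/\ (0 < c)%N,
        forall n r : nat, (0 < n)%N -> (0 < r)%N ->
          outputs c p n r (F n r) (T n r) /\
          strongly_selective n r [set B in F n r],
        Theta (fun n r => #|[set B in F n r]|)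
              (fun n r => Num.min (r%:R ^+ 2 * ln n%:R) n%:R : R),
        Theta (fun n r => size (F n r))
              (fun n r => Num.min (r%:R ^+ 2 * ln n%:R) n%:R : R)
      & Theta T (fun n r => r%:R * n%:R * ln n%:R : R)].
Proof.
have H n r : {lt : seq {set 'I_n} * nat | (0 < n)%N -> (0 < r)%N ->
    [/\ outputs 13 prog_main n r lt.1 lt.2,
      strongly_selective n r [set B in lt.1],
      (r * n * bits n <= lt.2 <= 100 * 100 * (r * n * bits n))%N &
      (minn n (r * r * bits n) <= #|[set B in lt.1]|)%N /\
      (size lt.1 <= 17 * minn n (r * r * bits n))%N]}.
  (* Choice turns the run for each [n] and [r] into functions for the family and the time; the
     values at n = 0 or r = 0 are arbitrary. *)
  apply: cid; have [n0|n0] := posnP n; first by exists ([::], 0%N); rewrite n0.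
  have [r0|r0] := posnP r; first by exists ([::], 0%N); rewrite r0.
  have [w3 wV] := word_size_large n0 r0.
  have [t [s [l [E tp tb ss sz]]]] := prog_mainP w3 n0 r0 wV.
  exists (l, t) => _ _; split=> //=; first by exists s.
  by rewrite [X in (_ <= _ <= X)%N]mulnC.
pose F n r := (sval (H n r)).1; pose T n r := (sval (H n r)).2.
have HF n r (n0 : (0 < n)%N) (r0 : (0 < r)%N) := svalP (H n r) n0 r0.
have c0 : 0 < ln 2 / 2 :> R by rewrite divr_gt0 ?ltr0n // ln_gt0 // ltr1n.
have c1 : ln 2 / 2 <= 1 :> R.
  by rewrite ler_pdivrMr ?ltr0n // mul1r (le_trans (ln2_le1 R)) // ler1n.
have card_le n r : (#|[set B in F n r]| <= size (F n r))%N.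
  by rewrite cardsE card_size.
(* The factor ln 2 / 2 from [ln_bits] passes through the minimum, being positive and at most 1. *)
have Hmin n r : (1 < n)%N -> (0 < r)%N ->
    ln 2 / 2 * (minn n (r * r * bits n))%:R
      <= (Num.min (r%:R ^+ 2 * ln n%:R) n%:R : R) <= (minn n
        (r * r * bits n))%:R.
  move=> n1 r0; have /andP[l1 l2] := @ln_bits R n n1.
  have r2 : 0 < (r%:R ^+ 2 : R) by rewrite exprn_gt0 ?ltr0n.
  have mE : (minn n (r * r * bits n))%:R =
    Num.min (r%:R ^+ 2 * (bits n)%:R) n%:R :> R.
    rewrite -natrX -natrM -mulnn minC; case: leqP => h.
      by rewrite min_l // ler_nat.
    by rewrite min_r // ler_nat ltnW.
  rewrite mE minr_pMr ?(ltW c0) //; apply/andP; split.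
    rewrite le_min !ge_min; apply/andP; split; apply/orP; [left|right].
      by rewrite mulrCA ler_pM2l.
    by rewrite ler_piMl // ler0n.
  rewrite le_min !ge_min; apply/andP; split; apply/orP; [left|right] => //.
  by rewrite ler_pM2l.
exists prog_main, 13%N, F, T; split=> //.
- by move=> n r n0 r0; have [h1 h2 _ _] := HF n r n0 r0.
- apply: (Theta_bits (m := fun n r => minn n (r * r * bits n)) (C :=
  17) c0 _ Hmin) => n r n1 r0.
  have [_ _ _ [h1 h2]] := HF n r (ltnW n1) r0.
  by rewrite h1 (leq_trans (card_le n r)).
- apply: (Theta_bits (m := fun n r => minn n (r * r * bits n)) (C :=
  17) c0 _ Hmin) => n r n1 r0.
  have [_ _ _ [h1 h2]] := HF n r (ltnW n1) r0.
  by rewrite h2 (leq_trans h1) ?card_le.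
- apply: (Theta_bits (m := fun n r => (r * n * bits n)%N) (C :=
  100 * 100) c0) => n r n1 r0.
    by have [_ _ h _] := HF n r (ltnW n1) r0.
  have /andP[l1 l2] := @ln_bits R n n1.
  have rn : 0 < (r%:R * n%:R : R) by rewrite mulr_gt0 ?ltr0n // ltnW.
  by rewrite !natrM mulrCA !ler_pM2l ?l1.
Qed.
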